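(* Let $a$ and $b$ be integers with $a\geq 2$ and $b\geq 2$. Then there are positive constants $c_1(a,b)$ and $c_2(a,b)$, depending only on $a$ and $b$, such that \begin{align*} c_1(a,b)\frac{x}{(\ln x)^{1-1/b}}&\leq\#\{1\leq n\leq x:\ \text{there are } p\in\mathbb{P}\text{ and } j\in\mathbb{Z}_{\geq 0}\text{ such that } p+a^{j^{b}}=n\}\\ &\leq c_2(a,b)\frac{x}{(\ln x)^{1-1/b}} \end{align*} for any real number $x\geq 3$.
   Context: $\mathbb{P}$ is the set of prime numbers, $\mathbb{Z}_{\geq 0}$ the set of non-negative integers; the variable $n$ runs over integers; $\ln$ is the natural logarithm; $a^{j^b}$ means $a^{(j^b)}$. *)

(* Defs.v *)
From HB Require Import structures.
From mathcomp Require Import all_boot all_order all_algebra finmap.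
From mathcomp Require Import all_classical all_reals all_analysis.
Set Implicit Arguments.
Unset Strict Implicit.
Unset Printing Implicit Defensive.
Import Order.TTheory GRing.Theory Num.Theory.
Local Open Scope classical_set_scope.
Local Open Scope ring_scope.

Definition prime_plus_power_upto (R : realType) (a b : nat) (x : R) : set nat :=
  [set n : nat | [/\ (1 <= n)%N, n%:R <= x
    & exists p j : nat, prime p /\ (p + a ^ (j ^ b) = n)%N]].

(* [fset_set] is only meaningful on finite sets. *)
Lemma finite_prime_plus_power_upto (R : realType) (a b : nat) (x : R) :
  finite_set (prime_plus_power_upto a b x).
Proof.
apply: (@sub_finite_set _ _ `I_(Num.truncn x).+1); last exact: finite_II.
move=> n [_ nx _] /=; rewrite ltnS -(natrK (R := R) n).
exact: le_truncn.
Qed.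

Definition count_prime_plus_power (R : realType) (a b : nat) (x : R) : nat :=
  #|` fset_set (prime_plus_power_upto a b x)|%fset.

(* Main.v *)
Require Import Defs.
From HB Require Import structures.
From mathcomp Require Import all_boot all_order all_algebra finmap.
From mathcomp Require Import all_classical all_reals all_analysis.
From mathcomp Require Import fintype finset zify ring lra.
Set Implicit Arguments.
Unset Strict Implicit.
Unset Printing Implicit Defensive.
Import Order.TTheory GRing.Theory Num.Theory.
Local Open Scope ring_scope.

(** The argument is Romanoff's. Let [2 ^ L <= x < 2 ^ L.+1], so that [ln x] has
    the order of [L].

    Upper bound. A number counted comes from a pair [(p, j)] with
    [p <= 2 ^ L.+1] and [j ^ b <= L.+1]. Chebyshev's bound
    ([prime_count_upper]) leaves [O (x / L)] choices for [p], and there are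
    [O (L ^ (1 / b))] choices for [j].

    Lower bound. Let [M = L - 1], and take the primes [p <= 2 ^ M] and the
    exponents [1 <= j <= J], where [J] is the largest integer with
    [a * J ^ b <= M]; the sums are then at most [x], and [J] has the order of
    [L ^ (1 / b)]. By Chebyshev's lower bound ([prime_count_lower]) there are at
    least a constant times [2 ^ M * J / M] pairs. By Cauchy-Schwarz ([image_collision_bound]) a positive proportion of
    them has distinct sums, provided that the number of solutions of
    [p + a ^ (j ^ b) = q + a ^ (i ^ b)] is [O (2 ^ M * J / M)]. The diagonal
    [i = j] is harmless. For [i < j] one counts primes [p] such that [p + h] is
    prime, where [h = a ^ (j ^ b) - a ^ (i ^ b)]. Selberg's sieve
    ([selberg_sieve], [prime_pair_count_upper]) bounds them by
    [O (2 ^ M / M ^ 2)] times the exponential of twice the sum of [1/p] over the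
    primes [p] dividing [2 * h].

    It remains to see that this exponential is bounded on average over the pairs
    [i < j] ([average_exp_prime_inverse_sum]). Up to the primes dividing [2 * a],
    only the primes dividing [a ^ m - 1] with [m = j ^ b - i ^ b] matter, and such
    a prime divides exactly when the order [e] of [a] modulo [p] divides [m]. Two
    facts are used. There are [O (E ^ 2)] primes for which the order is below [E],
    so that their [1/p] sum to [o (ln E)] ([prime_set_inverse_sum]). And the
    proportion of the pairs with [e] dividing [j ^ b - i ^ b] is at most a negative
    power of [e] ([power_difference_dvd_count]): a Vandermonde determinant shows
    that a short interval contains at most [b] solutions of a congruence
    [t ^ b = c] modulo [e]. *)

(** * Chebyshev bounds for the number of primes *)

Definition prime_count (m n : nat) : nat := (\sum_(m <= p < n | prime p) 1)%N.

Lemma coprime_prod_primes (s : seq nat) q : prime q -> all prime s -> q \notin s ->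
  coprime q (\prod_(p <- s) p).
Proof.
move=> qp sp qs; rewrite coprime_sym big_seq.
apply: (big_rec (fun m => coprime m q)) => [|p m ps mq]; first by rewrite coprime1n.
rewrite coprimeMl mq andbT prime_coprime ?(allP sp) //.
rewrite dvdn_prime2 ?qp ?(allP sp p ps) //.
by apply: contraNneq qs => pq; rewrite -pq.
Qed.

Lemma prod_primes_dvd (s : seq nat) n : uniq s -> all prime s ->
  (forall p, p \in s -> p %| n)%N -> (\prod_(p <- s) p %| n)%N.
Proof.
elim: s => [|q s IHs]; first by rewrite big_nil dvd1n.
move=> /= /andP[qs us] /andP[qp sp] sn; rewrite big_cons Gauss_dvd.
  rewrite sn ?mem_head// IHs// => p ps; apply: sn.
  by rewrite in_cons ps orbT.
exact: coprime_prod_primes.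
Qed.

(** The primes from [m + 1] to [2 * m] divide the central binomial coefficient
    [C(2 * m, m)], which is at most [2 ^ (2 * m)]. *)
Lemma prime_count_doubling m : (m ^ prime_count m.+1 (2 * m).+1 <= 4 ^ m)%N.
Proof.
have bm0 : (0 < 'C(2 * m, m))%N by rewrite bin_gt0; lia.
have -> : (4 ^ m = 2 ^ (2 * m))%N by rewrite expnM.
apply: (@leq_trans 'C(2 * m, m)); last first.
  have := Pascal 1 1 (2 * m); rewrite -[(1 + 1)%N]/2%N => ->.
  have mm : (m < (2 * m).+1)%N by lia.
  by rewrite (bigD1 (Ordinal mm)) //= !exp1n !muln1; lia.
apply: (@leq_trans (\prod_(p <- [seq p <- index_iota m.+1 (2 * m).+1 | prime p]) p)).
  rewrite /prime_count sum1_count -size_filter.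
  have : all (fun p => m <= p)%N [seq p <- index_iota m.+1 (2 * m).+1 | prime p].
    by apply/allP => p; rewrite mem_filter mem_index_iota; lia.
  elim: [seq _ <- _ | _] => [|p s IHs] /=; first by rewrite big_nil.
  by move=> /andP[mp /IHs ms]; rewrite big_cons expnS leq_mul.
apply: dvdn_leq => //; apply: prod_primes_dvd.
- by rewrite filter_uniq ?iota_uniq.
- by apply/allP => p; rewrite mem_filter => /andP[].
move=> p; rewrite mem_filter mem_index_iota => /and3P[pp mp pm].
have : (p %| (2 * m)`!)%N by rewrite dvdn_fact // prime_gt0 //; lia.
have mm : (m <= 2 * m)%N by lia.
rewrite -(bin_fact mm) Euclid_dvdM // => /orP[//|].
have -> : (2 * m - m = m)%N by lia.
rewrite Euclid_dvdM // orbb.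
move=> pfm; exfalso.
have : (p %| \prod_(1 <= i < m.+1) i)%N by rewrite -fact_prod.
elim: (m) mp => [|k IHk] kp; first by rewrite big_geq // dvdn1 => /eqP p1; rewrite p1 in pp.
rewrite big_nat_recr //= Euclid_dvdM // => /orP[|]; first by apply: IHk; lia.
by move/dvdn_leq; lia.
Qed.

(** At powers of two the doubling inequality reads off exponents, so no
    logarithm is needed. *)
Lemma prime_count_dyadic i :
  (i * prime_count (2 ^ i).+1 (2 ^ i.+1).+1 <= 2 ^ i.+1)%N.
Proof.
have := prime_count_doubling (2 ^ i); rewrite -expnS -!expnM.
have -> : (4 ^ (2 ^ i) = 2 ^ (2 ^ i.+1))%N by rewrite expnS expnM.
by rewrite leq_exp2l.
Qed.

Lemma prime_count_cat m n k : (m <= n)%N -> (n <= k)%N ->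
  prime_count m k = (prime_count m n + prime_count n k)%N.
Proof. by move=> mn nk; rewrite /prime_count (big_cat_nat mn nk). Qed.

(** Chebyshev's upper bound, by summing over dyadic blocks. *)
Lemma prime_count_upper L : (L * prime_count 0 (2 ^ L).+1 <= 6 * 2 ^ L)%N.
Proof.
case: L => [//|L]; elim: L => [|L IHL].
  by rewrite /prime_count unlock.
case: L IHL => [|L IHL].
  by rewrite /prime_count unlock.
rewrite (@prime_count_cat 0 (2 ^ L.+2).+1); last 2 first.
- by [].
- by rewrite ltnS leq_exp2l.
have := prime_count_dyadic L.+2.
move: IHL; set u := prime_count 0 _; set v := prime_count _ _.
rewrite !(expnS 2); have : (0 < 2 ^ L)%N by rewrite expn_gt0.
set t := (2 ^ L)%N; nia.
Qed.

Lemma bin_central_lower m : (2 ^ m <= 'C(2 * m, m))%N.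
Proof.
elim: m => [//|m IHm].
have : (m.+1 * 'C(2 * m.+1, m.+1) = 2 * (2 * m).+1 * 'C(2 * m, m))%N.
  have -> : (2 * m.+1 = (2 * m).+2)%N by lia.
  have /= := mul_bin_diag (2 * m).+2 m; have /= := mul_bin_down (2 * m).+1 m.
  have -> : ((2 * m).+1 - m = m.+1)%N by lia.
  nia.
rewrite expnS; nia.
Qed.

(** In Legendre's formula the power [p ^ k] contributes the integer part of
    [2 * m / p ^ k] minus twice that of [m / p ^ k]: at most [1], and [0] as soon as
    [2 * m < p ^ k]. *)
Lemma logn_bin_central p m : prime p ->
  (logn p 'C(2 * m, m) <= trunc_log p (2 * m))%N.
Proof.
move=> pp; have p1 := prime_gt1 pp.
case: (posnP m) => [->|m0]; first by rewrite bin0 logn1.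
have mm : (m <= 2 * m)%N by lia.
have := congr1 (logn p) (bin_fact mm).
have -> : (2 * m - m = m)%N by lia.
rewrite !lognM ?muln_gt0 ?fact_gt0 ?bin_gt0 // !logn_fact //.
set T := trunc_log p (2 * m).
have -> : (\sum_(1 <= k < m.+1) m %/ p ^ k =
           \sum_(1 <= k < (2 * m).+1) m %/ p ^ k)%N.
  have mm' : (m.+1 <= (2 * m).+1)%N by lia.
  rewrite [RHS](big_cat_nat _ mm') //= [X in (_ + X)%N]big_nat [X in (_ + X)%N]big1 ?addn0 // => k kn.
  by apply: divn_small; apply: leq_trans (ltn_expl k p1); lia.
have : (\sum_(1 <= k < (2 * m).+1) (2 * m) %/ p ^ k <=
        2 * (\sum_(1 <= k < (2 * m).+1) m %/ p ^ k) + T)%N.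
  have Tm : (T <= 2 * m)%N.
    by rewrite -(leq_exp2l _ _ p1); apply: leq_trans (trunc_logP p1 _) (ltnW (ltn_expl _ p1)); lia.
  have -> : (T = \sum_(1 <= k < (2 * m).+1) (k <= T))%N.
    rewrite (@big_cat_nat _ _ _ T.+1) //=.
    rewrite (eq_big_nat _ _ (F2 := fun=> 1%N)); last by move=> k; lia.
    rewrite [X in (_ + X)%N](eq_big_nat _ _ (F2 := fun=> 0%N)); last by move=> k; lia.
    by rewrite big1_eq sum_nat_const_nat; lia.
  rewrite big_distrr -big_split /=; apply: leq_sum => k _.
  have [kT|Tk] := leqP k T.
    have pk : (0 < p ^ k)%N by rewrite expn_gt0; lia.
    have := ltn_ceil m pk; have := leq_trunc_div (2 * m) (p ^ k).
    move: (_ ^ _)%N pk => q; nia.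
  rewrite divn_small //; apply: leq_trans (trunc_log_ltn _ p1) _.
  by rewrite leq_exp2l.
lia.
Qed.

(** Chebyshev's lower bound: every prime power dividing [C(2m,m)] is at most
    [2m], so [2 ^ m <= C(2m,m) <= (2m) ^ pi(2m)]. *)
Lemma prime_count_lower i : (2 ^ i <= i.+1 * prime_count 0 (2 ^ i.+1).+1)%N.
Proof.
set m := (2 ^ i)%N; have m0 : (0 < m)%N by rewrite expn_gt0.
have b0 : (0 < 'C(2 * m, m))%N by rewrite bin_gt0; lia.
have : ('C(2 * m, m) <= (2 * m) ^ prime_count 0 (2 * m).+1)%N.
  rewrite {1}(prod_prime_decomp b0) prime_decompE big_map /=.
  have le2m p : p \in primes 'C(2 * m, m) -> (p ^ logn p 'C(2 * m, m) <= 2 * m)%N.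
    rewrite mem_primes => /and3P[pp _ _].
    apply: (@leq_trans (p ^ trunc_log p (2 * m))).
      by rewrite leq_exp2l ?prime_gt1 // logn_bin_central.
    by apply: trunc_logP (prime_gt1 pp) _; lia.
  apply: (@leq_trans ((2 * m) ^ size (primes 'C(2 * m, m)))).
    elim: (primes _) le2m => [|p s IHs] le2m; first by rewrite big_nil.
    rewrite big_cons expnS leq_mul ?le2m ?mem_head // IHs // => q qs.
    by rewrite le2m // in_cons qs orbT.
  rewrite leq_pexp2l; [by []|by lia|].
  rewrite /prime_count sum1_count -size_filter.
  apply: uniq_leq_size; first exact: primes_uniq.
  move=> p pb; move: (le2m p pb); move: pb.
  rewrite -logn_gt0 mem_filter mem_index_iota lognE.
  case: ifP => // /and3P[pp _ _] _; rewrite pp /= ltnS => le.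
  by apply: leq_trans le; rewrite -{1}(expn1 p) leq_exp2l ?prime_gt1.
rewrite expnS -/m => h; have := leq_trans (bin_central_lower m) h.
by rewrite -expnS -expnM leq_exp2l.
Qed.

(** * The Selberg sieve *)

(** Expand [\prod_i (a i + b i)], where the terms of the expansion that survive
    are those indexed by the sets between [F] and [E]. *)
Lemma sum_between_prod (R : comPzRingType) (I : finType) (F E : {set I}) (c : I -> R) :
  F \subset E ->
  \sum_(J : {set I} | (F \subset J) && (J \subset E)) \prod_(i in J) c i =
  (\prod_(i in F) c i) * \prod_(i in E :\: F) (1 + c i).
Proof.
move=> FE.
transitivity (\prod_i ((if i \in E then c i else 0) + (if i \in F then 0 else 1))).
  rewrite bigA_distr big_mkcond /=; apply: eq_bigr => J _.
  case: ifP => [/andP[FJ JE]|].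
    rewrite big_mkcond; apply: eq_bigr => i _; case: ifPn => iJ.
      by rewrite (subsetP JE).
    by rewrite ifN //; apply: contra iJ; apply: (subsetP FJ).
  move=> /negbT; rewrite negb_and => /orP[] /subsetPn[i i1 i2].
    by rewrite (bigD1 i) //= (negbTE i2) i1 mul0r.
  by rewrite (bigD1 i) //= i1 (negbTE i2) mul0r.
rewrite [X in _ = X * _]big_mkcond [X in _ = _ * X]big_mkcond -big_split /=.
apply: eq_bigr => i _; rewrite inE; case: (boolP (i \in F)) => iF /=.
  by rewrite (subsetP FE) // addr0 mulr1.
by case: ifP; rewrite ?mul1r ?add0r // addrC.
Qed.

Lemma sum_subset_prod (R : comPzRingType) (I : finType) (E : {set I}) (c : I -> R) :
  \sum_(J : {set I} | J \subset E) \prod_(i in J) c i = \prod_(i in E) (1 + c i).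
Proof.
have := sum_between_prod c (sub0set E); rewrite setD0 big_set0 mul1r => <-.
by apply: eq_bigl => J; rewrite sub0set.
Qed.

(** Moebius inversion on the lattice of finite sets. *)
Lemma sum_between_sign (R : comPzRingType) (I : finType) (F E : {set I}) :
  F \subset E ->
  \sum_(J : {set I} | (F \subset J) && (J \subset E)) (-1) ^+ #|J| =
  if F == E then (-1) ^+ #|F| else 0 :> R.
Proof.
move=> FE; have := sum_between_prod (fun=> -1 : R) FE.
rewrite prodr_const => e.
transitivity (\sum_(J : {set I} | (F \subset J) && (J \subset E)) \prod_(i in J) (-1 : R)).
  by apply: eq_bigr => J _; rewrite prodr_const.
rewrite e; case: eqVneq => [<-|nFE].
  by rewrite setDv big_set0 mulr1.
have /set0Pn[i iEF] : E :\: F != set0.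
  by rewrite setD_eq0; apply: contra nFE => EF; rewrite eqEsubset FE.
by rewrite (bigD1 i) //= addrN mul0r mulr0.
Qed.

Lemma prod_setUI (R : comPzRingType) (I : finType) (D E : {set I}) (g : I -> R) :
  (\prod_(i in D :|: E) g i) * (\prod_(i in D :&: E) g i) =
  (\prod_(i in D) g i) * (\prod_(i in E) g i).
Proof.
rewrite ![\prod_(i in _) _]big_mkcond -!big_split /=; apply: eq_bigr => i _.
rewrite !inE; case: (i \in D); case: (i \in E) => //=.
by rewrite mulrC.
Qed.

(** The inverse of this sum is the minimum of the quadratic form that
    [selberg_weight] minimises. *)
Definition sieve_mass (R : realFieldType) (I : finType) (g : I -> R)
    (FF : {set {set I}}) : R :=
  \sum_(F in FF) \prod_(i in F) (g i / (1 - g i)).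

(** Selberg's weights: the minimisers of the quadratic form
    [\sum_(D, E) l D * l E * \prod_(i in D :|: E) g i] with [l set0 = 1]. *)
Definition selberg_weight (R : realFieldType) (I : finType) (g : I -> R)
    (FF : {set {set I}}) (D : {set I}) : R :=
  (-1) ^+ #|D| / (\prod_(i in D) g i) / sieve_mass g FF *
  \sum_(F in FF | D \subset F) \prod_(i in F) (g i / (1 - g i)).

(** The indicator of [hit n == set0] is at most the square of the sum of [l D]
    over the sets [D] of the family contained in [hit n], because [l set0 = 1].
    Summing over [n] gives [X] times the quadratic form of
    [selberg_weight], which is diagonal in the coordinates
    [\sum_(D in FF | F \subset D) l D * \prod_(i in D) g i], plus a remainder. The
    remainder is estimated with [`|l D| <= (\prod_(i in D) g i)^-1] only: this is
    enough when the level of the sieve is a small power of the length. *)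
Lemma selberg_sieve (R : realFieldType) (I : finType) (g : I -> R)
    (FF : {set {set I}}) (T : Type) (s : seq T) (hit : T -> {set I}) (X : R)
    (r : {set I} -> R) :
  (forall i, 0 < g i < 1) -> set0 \in FF ->
  (forall D E : {set I}, D \subset E -> E \in FF -> D \in FF) ->
  (forall D E, D \in FF -> E \in FF ->
    `|(count (fun n => D :|: E \subset hit n) s)%:R - X * \prod_(i in D :|: E) g i|
      <= r (D :|: E)) ->
  (count (fun n => hit n == set0) s)%:R <=
  X / sieve_mass g FF +
  \sum_(D in FF) \sum_(E in FF)
     r (D :|: E) / ((\prod_(i in D) g i) * (\prod_(i in E) g i)).
Proof.
move=> g01 FF0 FFd hr.
have g0 i : 0 < g i by case/andP: (g01 i).
have g1 i : 0 < 1 - g i by rewrite subr_gt0; case/andP: (g01 i).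
pose w i := g i / (1 - g i).
have w0 i : 0 < w i by rewrite divr_gt0.
pose pg (D : {set I}) := \prod_(i in D) g i.
pose pw (D : {set I}) := \prod_(i in D) w i.
have pg0 D : 0 < pg D by apply: prodr_gt0.
have pw0 D : 0 < pw D by apply: prodr_gt0.
set G := sieve_mass g FF.
have G0 : 0 < G.
  rewrite /G /sieve_mass (bigD1 set0) //= ltr_wpDr ?pw0 //.
  by apply: sumr_ge0 => F _; apply/ltW/pw0.
pose l := selberg_weight g FF.
have l0 : l set0 = 1.
  rewrite /l /selberg_weight cards0 big_set0 invr1 mulr1 mul1r.
  under eq_bigl do rewrite sub0set andbT.
  by rewrite mulVf // gt_eqF.
have labs D : `|l D| <= (pg D)^-1.
  rewrite /l /selberg_weight -/G -/(pg D) !normrM normrX normrN1 expr1n mul1r.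
  rewrite !normfV (gtr0_norm (pg0 D)) (gtr0_norm G0) -mulrA ger_pMr ?invr_gt0 //.
  rewrite ler_pdivrMl // mulr1 ger0_norm; last first.
    by apply: sumr_ge0 => F _; apply/ltW/pw0.
  rewrite /G /sieve_mass [leRHS](bigID (fun F : {set I} => D \subset F)) /= lerDl.
  by apply: sumr_ge0 => F _; apply/ltW/pw0.
(* only [E = F] survives the alternating sum over the sets between [F] and [E] *)
have inv F : F \in FF -> \sum_(D in FF | F \subset D) l D * pg D =
    (-1) ^+ #|F| * pw F / G.
  move=> FFF.
  transitivity (\sum_(E in FF | F \subset E) \sum_(D : {set I} | (F \subset D) && (D \subset E))
       (-1) ^+ #|D| * (pw E / G)).
    transitivity (\sum_(D in FF | F \subset D) \sum_(E in FF | D \subset E)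
         (-1) ^+ #|D| * (pw E / G)).
      apply: eq_bigr => D _; rewrite /l /selberg_weight -/G -/(pg D).
      rewrite -big_distrr /= -big_distrl /= -/w.
      have := lt0r_neq0 (pg0 D); move: (pg D) => a a0.
      by field; rewrite a0 gt_eqF.
    rewrite (exchange_big_dep (fun E => (E \in FF) && (F \subset E))) /=; last first.
      by move=> D E /andP[_ FD] /andP[-> /(subset_trans FD)].
    apply: eq_bigr => E /andP[EFF _]; apply: eq_bigl => D.
    rewrite EFF /=; case: (boolP (D \subset E)) => [/FFd->//|].
    by rewrite !andbF.
  rewrite (bigD1 F) /=; last by rewrite FFF subxx.
  rewrite -big_distrl /= sum_between_sign // eqxx big1 ?addr0 ?mulrA //.
  move=> E /andP[/andP[_ FE] nEF].
  by rewrite -big_distrl /= sum_between_sign // eq_sym (negbTE nEF) mul0r.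
(* expanding [(pg (D :&: E))^-1] over the subsets [F] of [D :&: E] separates [D]
   from [E] *)
have quad : \sum_(D in FF) \sum_(E in FF) l D * l E * pg (D :|: E) = G^-1.
  transitivity (\sum_(F in FF) (pw F)^-1 * (\sum_(D in FF | F \subset D) l D * pg D) ^+ 2).
    transitivity (\sum_(D in FF) \sum_(E in FF)
        \sum_(F in FF | (F \subset D) && (F \subset E)) (pw F)^-1 * ((l D * pg D) * (l E * pg E))).
      apply: eq_bigr => D DFF; apply: eq_bigr => E EFF.
      rewrite -big_distrl /=.
      have -> : \sum_(F in FF | (F \subset D) && (F \subset E)) (pw F)^-1 = (pg (D :&: E))^-1.
        transitivity (\prod_(i in D :&: E) (1 + (w i)^-1)).
          rewrite -sum_subset_prod; apply: eq_big => F.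
            rewrite subsetI; case: (boolP (F \subset D)); rewrite ?andbF //=.
            by move/FFd => -> //.
          by move=> _; rewrite prodfV.
        rewrite /pg -prodfV; apply: eq_bigr => i _.
        have := g1 i; have := g0 i; rewrite /w => a b.
        by field; rewrite !gt_eqF.
      have := prod_setUI D E g; rewrite -/(pg _) -/(pg _) -/(pg D) -/(pg E) => e.
      have -> : (pg (D :&: E))^-1 * (l D * pg D * (l E * pg E)) =
         (pg (D :&: E))^-1 * (l D * l E) * (pg D * pg E) by ring.
      rewrite -e; have := pg0 (D :&: E) => h; field.
      by rewrite gt_eqF.
    transitivity (\sum_(F in FF) \sum_(D in FF | F \subset D) \sum_(E in FF | F \subset E)
        (pw F)^-1 * ((l D * pg D) * (l E * pg E))).
      transitivity (\sum_(D in FF) \sum_(F in FF | F \subset D) \sum_(E in FF | F \subset E)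
        (pw F)^-1 * ((l D * pg D) * (l E * pg E))).
        apply: eq_bigr => D DFF.
        rewrite (exchange_big_dep (fun F => (F \in FF) && (F \subset D))) /=; last first.
          by move=> E F _ /and3P[-> ->].
        apply: eq_bigr => F /andP[FFF FD]; apply: eq_bigl => E.
        by rewrite FFF FD.
      rewrite (exchange_big_dep (mem FF)) //=; last by move=> D F _ /andP[].
      by apply: eq_bigr => F FFF; apply: eq_bigl => D; rewrite FFF.
    apply: eq_bigr => F _; rewrite expr2 big_distrlr /= big_distrr /=.
    by apply: eq_bigr => D _; rewrite big_distrr.
  transitivity (\sum_(F in FF) pw F * (G ^- 2)).
    apply: eq_bigr => F FFF; rewrite inv //.
    have h := lt0r_neq0 (pw0 F); have h' := lt0r_neq0 G0.
    rewrite !exprMn -exprM mulnC exprM sqrrN expr1n expr1n mul1r.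
    by field; rewrite h h'.
  rewrite -big_distrl /= -/(sieve_mass g FF) -/G.
  have h' := lt0r_neq0 G0; by field.
have major n : (hit n == set0)%:R <=
    \sum_(D in FF) \sum_(E in FF) l D * l E * (D :|: E \subset hit n)%:R.
  have -> : \sum_(D in FF) \sum_(E in FF) l D * l E * (D :|: E \subset hit n)%:R =
     (\sum_(D in FF) l D * (D \subset hit n)%:R) ^+ 2.
    rewrite expr2 big_distrlr /=; apply: eq_bigr => D _; apply: eq_bigr => E _.
    by rewrite subUset -mulnb natrM; ring.
  case: eqP => [h|_] /=; last exact: sqr_ge0.
  rewrite (bigD1 set0) //= h sub0set mulr1 l0 big1 ?addr0 ?expr1n //.
  by move=> D /andP[_ D0]; rewrite subset0 (negbTE D0) mulr0.
have cnt (P : pred T) : (count P s)%:R = \sum_(n <- s) (P n)%:R :> R.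
  by rewrite -sum1_count natr_sum big_mkcond; apply: eq_bigr => n _; case: (P n).
rewrite cnt; apply: (le_trans (ler_sum _ (fun n _ => major n))).
rewrite exchange_big /=.
have -> : X / G = \sum_(D in FF) \sum_(E in FF) l D * l E * (X * pg (D :|: E)).
  rewrite -quad big_distrr /=; apply: eq_bigr => D _; rewrite big_distrr /=.
  by apply: eq_bigr => E _; ring.
rewrite -big_split /=; apply: ler_sum => D DFF.
rewrite exchange_big -big_split /=; apply: ler_sum => E EFF.
rewrite -big_distrr /= -cnt -lerBlDl -mulrBr.
apply: le_trans (ler_norm _) _; rewrite 2!normrM -/(pg D) -/(pg E) invfM mulrC.
apply: ler_pM; [exact: normr_ge0|exact: mulr_ge0|exact: hr|].
by apply: ler_pM.
Qed.

(** * Sieving the products [n * (n + h)] *)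

Lemma count_iota_card (P : pred nat) n : count P (iota 0 n) = #|[set i : 'I_n | P i]|.
Proof.
rewrite cardsE cardE /enum_mem size_filter -enumT -val_enum_ord count_map.
by apply: eq_count.
Qed.

(** The Chinese remainder theorem as a statement about densities. *)
Lemma count_iota_coprime (P Q : pred nat) m k :
  (0 < m)%N -> (0 < k)%N -> coprime m k ->
  (forall n, P (n %% m)%N = P n) -> (forall n, Q (n %% k)%N = Q n) ->
  (count (predI P Q) (iota 0 (m * k)) = count P (iota 0 m) * count Q (iota 0 k))%N.
Proof.
move=> m0 k0 mk Pm Qk; rewrite !count_iota_card.
pose f (x : 'I_(m * k)) := (Ordinal (ltn_pmod x m0), Ordinal (ltn_pmod x k0)).
have finj : injective f.
  move=> x y [xym xyk]; apply: val_inj => /=.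
  rewrite -[LHS](modn_small (ltn_ord x)) -[RHS](modn_small (ltn_ord y)).
  by apply/eqP; rewrite chinese_remainder // xym xyk !eqxx.
have fbij : bijective f.
  by apply: inj_card_bij => //; rewrite card_prod !card_ord.
rewrite -cardsX -(on_card_preimset (onW_bij _ fbij)).
by apply: eq_card => x; rewrite !inE /= Pm Qk.
Qed.

Lemma count_iota_periodic (P : pred nat) d q r :
  (forall n, P (n + d)%N = P n) ->
  (count P (iota 0 (q * d + r)) = q * count P (iota 0 d) + count P (iota 0 r))%N.
Proof.
move=> Pd; elim: q => [|q IHq]; first by rewrite !mul0n.
rewrite !mulSn -!addnA iotaD count_cat -IHq; congr (_ + _)%N.
rewrite -[X in iota X](addn0 d) iotaDl count_map; apply: eq_count => n /=.
by rewrite addnC Pd.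
Qed.

(** The complete periods contribute exactly their share; the error comes from the
    last, incomplete one. *)
Lemma count_iota_density (R : realFieldType) (P : pred nat) d N :
  (0 < d)%N -> (forall n, P (n + d)%N = P n) ->
  `|(count P (iota 0 N))%:R - N%:R * ((count P (iota 0 d))%:R / d%:R)|
    <= (count P (iota 0 d))%:R :> R.
Proof.
move=> d0 Pd; rewrite {1 2}(divn_eq N d) count_iota_periodic //.
have rd := ltn_pmod N d0; set r := (N %% d)%N in rd *; set q := (N %/ d)%N.
set c := count P (iota 0 d).
have cr : (count P (iota 0 r) <= c)%N.
  by rewrite /c -(subnKC (ltnW rd)) iotaD count_cat leq_addr.
have d0' : (d%:R : R) != 0 by rewrite pnatr_eq0 -lt0n.
have -> : (q * c + count P (iota 0 r))%:R - (q * d + r)%:R * (c%:R / d%:R) =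
    (count P (iota 0 r))%:R - r%:R / d%:R * c%:R :> R.
  by rewrite !natrD !natrM; field.
have h1 : (count P (iota 0 r))%:R <= c%:R :> R by rewrite ler_nat.
have h2 : 0 <= r%:R / d%:R * c%:R :> R by rewrite !mulr_ge0 ?invr_ge0.
have h3 : r%:R / d%:R * c%:R <= c%:R :> R.
  rewrite ler_piMl // ler_pdivrMr ?ltr0n // mul1r ler_nat; exact: ltnW.
have h4 : 0 <= (count P (iota 0 r))%:R :> R by [].
by rewrite ler_norml; lra.
Qed.

Lemma count_prime_pair_residues p h : prime p -> ~~ (p %| h)%N ->
  count (fun n => p %| n * (n + h))%N (iota 0 p) = 2%N.
Proof.
move=> pp ph; have p0 := prime_gt0 pp.
have hm : (0 < h %% p)%N by rewrite lt0n.
have hp := ltn_pmod h p0.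
rewrite -size_filter; suff /perm_size-> :
  perm_eq [seq n <- iota 0 p | p %| n * (n + h)]%N [:: 0; p - h %% p]%N by [].
apply: uniq_perm; first by rewrite filter_uniq ?iota_uniq.
  by rewrite /= inE andbT; lia.
move=> n; rewrite mem_filter mem_iota !inE Euclid_dvdM // add0n /=.
have [np|pn] := ltnP n p; last first.
  by rewrite andbF; apply/esym/negbTE; rewrite negb_or; lia.
rewrite andbT; congr (_ || _).
  case: n np => [|n] np; first by rewrite dvdn0.
  by rewrite gtnNdvd.
rewrite /dvdn -modnDmr; apply/eqP/eqP => [|->]; last first.
  by rewrite subnK ?modnn // ltnW.
move: hm hp; set t := (h %% p)%N => t0 tp.
have [ntp|pnt] := ltnP (n + t) p; first by rewrite modn_small //; lia.
by rewrite -(subnK pnt) modnDr modn_small; lia.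
Qed.

Lemma prod_primes_gt0 (s : seq nat) : all prime s -> (0 < \prod_(p <- s) p)%N.
Proof.
move=> sp; rewrite big_seq; apply: (big_ind (fun m => 0 < m)%N) => //.
  by move=> m n m0 n0; rewrite muln_gt0 m0.
by move=> p /(allP sp)/prime_gt0.
Qed.

Lemma count_prime_pairs_residues (s : seq nat) h :
  uniq s -> all prime s -> all (fun p => ~~ (p %| h)%N) s ->
  count (fun n => all (fun p => p %| n * (n + h))%N s) (iota 0 (\prod_(p <- s) p)) =
  (2 ^ size s)%N.
Proof.
elim: s => [|q s IHs]; first by rewrite big_nil.
move=> /= /andP[qs us] /andP[qp sp] /andP[qh sh]; rewrite big_cons.
have per p n m : (p %| m)%N -> (p %| n %% m * (n %% m + h))%N = (p %| n * (n + h))%N.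
  move=> pm; rewrite /dvdn -[in LHS]modnMml -[in LHS]modnMmr -[in RHS]modnMml.
  by rewrite -[in RHS]modnMmr modn_dvdm // -modnDml modn_dvdm // modnDml.
rewrite (@count_iota_coprime (fun n => q %| n * (n + h))%N
  (fun n => all (fun p => p %| n * (n + h))%N s)).
- by rewrite count_prime_pair_residues // IHs // expnS.
- exact: prime_gt0.
- exact: prod_primes_gt0.
- exact: coprime_prod_primes.
- by move=> n; rewrite per.
move=> n; apply: eq_in_all => p ps; rewrite per //.
by rewrite (big_rem p ps) /= dvdn_mulr.
Qed.

(** Modulo such a prime, [n * (n + h)] vanishes in exactly two classes, and the
    density [2 / p] is less than [1]: this is what rules out [2] and the divisors
    of [h]. *)
Definition sieving_prime y h (i : 'I_y.+1) : bool :=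
  [&& prime i, odd i & ~~ (i %| h)%N].

Definition sieve_family y h z : {set {set 'I_y.+1}} :=
  [set D : {set 'I_y.+1} | (D \subset sieving_prime h) && (\prod_(i in D) i <= z)%N].

(** The value [2^-1] is a default: the sieve wants a density strictly between [0]
    and [1] at every index. *)
Definition pair_density (R : realFieldType) y h (i : 'I_y.+1) : R :=
  if sieving_prime h i then 2 / i%:R else 2^-1.

Lemma sieving_prime_dvd_prod y h (D : {set 'I_y.+1}) (i : 'I_y.+1) :
  D \subset sieving_prime h -> sieving_prime h i ->
  (i \in D) = (i %| \prod_(j in D) j)%N.
Proof.
move=> /subsetP Ds /and3P[ip _ _]; apply/idP/idP => [iD|].
  by rewrite (bigD1 i) //= dvdn_mulr.
apply: contraLR => iD; rewrite -prime_coprime // coprime_sym.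
apply: (big_ind (fun m => coprime m i)) => [|m n mi ni|j jD].
- by rewrite coprime1n.
- by rewrite coprimeMl mi.
have /and3P[jp _ _] := Ds j jD.
rewrite prime_coprime // dvdn_prime2 //.
by apply: contraNneq iD => /val_inj <-.
Qed.

Lemma card_sieve_family y h z : (#|sieve_family y h z| <= z)%N.
Proof.
pose f (D : {set 'I_y.+1}) : 'I_z.+1 := inord (\prod_(i in D) i).
have fE D : D \in sieve_family y h z -> f D = (\prod_(i in D) i)%N :> nat.
  by rewrite inE => /andP[_ Dz]; rewrite /f inordK.
have finj : {in sieve_family y h z &, injective f}.
  move=> D E DF EF fDE.
  have := fE _ EF; rewrite -fDE fE // => e.
  move: DF EF; rewrite !inE => /andP[DF _] /andP[EF _].
  apply/setP => i; case: (boolP (sieving_prime h i)) => ip.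
    by rewrite !(sieving_prime_dvd_prod (h := h)) // e.
  have out (U : {set 'I_y.+1}) : U \subset sieving_prime h -> (i \in U) = false.
    by move=> /subsetP Us; apply: contraNF ip => /Us.
  by rewrite !out.
rewrite -(card_in_imset finj).
apply: (@leq_trans #|[set~ ord0 : 'I_z.+1]|); last by rewrite cardsC1 card_ord.
apply/subset_leq_card/subsetP => _ /imsetP[D DF ->].
rewrite !inE -val_eqE /= fE // -lt0n prodn_cond_gt0 // => i iD.
by move: DF; rewrite inE => /andP[/subsetP/(_ i iD)/and3P[/prime_gt0]].
Qed.

(** A term of the remainder is at most [z * z], since [2 ^ #|D|] is cancelled by the
    densities and the product of the primes in [D] is at most [z]; and the family
    has at most [z] members, since a set of primes is determined by its product. *)
Lemma prime_pair_sieve (R : realFieldType) y h z N : (0 < z)%N ->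
  (count (fun n => [forall i : 'I_y.+1, sieving_prime h i ==> ~~ (i %| n * (n + h))%N])
     (iota 0 N))%:R
  <= N%:R / sieve_mass (pair_density R h) (sieve_family y h z) + (z ^ 4)%:R :> R.
Proof.
move=> z0; set g := pair_density R h; set FF := sieve_family y h z.
pose hit n := [set i : 'I_y.+1 | sieving_prime h i && (i %| n * (n + h))%N].
have odd3 (i : 'I_y.+1) : sieving_prime h i -> (2 < i)%N.
  by case/and3P => ip io _; have := prime_gt1 ip; case: (nat_of_ord i) io => [|[|[|]]].
have g01 i : 0 < g i < 1.
  rewrite /g /pair_density; case: ifP => [/odd3 i3|_]; last by lra.
  have i0 : 0 < i%:R :> R by rewrite ltr0n; lia.
  by rewrite divr_gt0 // ltr_pdivrMr // mul1r ltr_nat.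
have gprod (D : {set 'I_y.+1}) : D \subset sieving_prime h ->
    \prod_(i in D) g i = (2 ^ #|D|)%:R / (\prod_(i in D) i)%:R.
  move=> /subsetP Ds; rewrite natrX natr_prod -prodr_const -prodf_div.
  by apply: eq_bigr => i /Ds is_; rewrite /g /pair_density ifT.
have FF0 : set0 \in FF by rewrite inE big_set0 z0 andbT; apply/subsetP => i; rewrite inE.
have prod_gt0 (D : {set 'I_y.+1}) : D \subset sieving_prime h -> (0 < \prod_(i in D) i)%N.
  by move=> /subsetP Ds; apply: prodn_cond_gt0 => i /Ds/and3P[/prime_gt0].
have FFd (D E : {set 'I_y.+1}) : D \subset E -> E \in FF -> D \in FF.
  move=> DE; rewrite !inE => /andP[Es Ez]; rewrite (subset_trans DE Es) /=.
  apply: leq_trans Ez; rewrite [leqRHS](big_setID D) /= (setIidPr DE).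
  rewrite leq_pmulr // prod_gt0 //.
  by apply: subset_trans Es; apply: subsetDl.
have hr (D E : {set 'I_y.+1}) : D \in FF -> E \in FF ->
    `|(count (fun n => D :|: E \subset hit n) (iota 0 N))%:R - N%:R * \prod_(i in D :|: E) g i|
      <= (2 ^ #|D :|: E|)%:R.
  rewrite !inE => /andP[Ds _] /andP[Es _].
  have Us : D :|: E \subset sieving_prime h.
    by apply/subsetP => i; rewrite inE => /orP[]; apply: subsetP.
  move: (D :|: E) Us => U Us; rewrite gprod //.
  pose s := [seq nat_of_ord i | i <- enum U].
  have sU : (\prod_(i in U) i = \prod_(p <- s) p)%N by rewrite big_map big_enum.
  have us : uniq s by rewrite map_inj_uniq ?enum_uniq //; apply: val_inj.
  have sP p : p \in s -> prime p && ~~ (p %| h)%N.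
    by case/mapP => i; rewrite mem_enum => /(subsetP Us)/and3P[ip _ ih] ->; rewrite ip.
  have sp : all prime s by apply/allP => p /sP/andP[].
  have sh : all (fun p => ~~ (p %| h)%N) s by apply/allP => p /sP/andP[].
  have e n : (U \subset hit n) = all (fun p => p %| n * (n + h))%N s.
    apply/subsetP/allP => [Uh p /mapP[i]|Uh i iU].
      by rewrite mem_enum => /Uh; rewrite inE => /andP[_ ?] ->.
    rewrite inE (subsetP Us i iU : sieving_prime h i) Uh //.
    by apply/mapP; exists i; rewrite ?mem_enum.
  rewrite (eq_count e) sU cardE -(size_map (@nat_of_ord _)) -/s.
  rewrite -(count_prime_pairs_residues us sp sh); apply: count_iota_density.
    exact: prod_primes_gt0.
  move=> n; apply: eq_in_all => p ps.
  have : (p %| \prod_(p <- s) p)%N by rewrite (big_rem p ps) dvdn_mulr.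
  move: (\prod_(p <- s) p)%N => m pm.
  rewrite /dvdn -modnMml -modnMmr -[in RHS]modnMml -[in RHS]modnMmr.
  move: pm; rewrite /dvdn => /eqP pm.
  by rewrite -(modnDmr n m) pm addn0 addnAC -(modnDmr (n + h) m) pm addn0.
have := selberg_sieve (hit := hit) (r := fun U => (2 ^ #|U|)%:R) g01 FF0 FFd hr.
have -> : count (fun n => hit n == set0) (iota 0 N) =
   count (fun n => [forall i : 'I_y.+1, sieving_prime h i ==> ~~ (i %| n * (n + h))%N]) (iota 0 N).
  apply: eq_count => n; apply/eqP/forallP => [/setP h0 i|h0].
    by apply/implyP => si; have := h0 i; rewrite !inE si /= => ->.
  by apply/setP => i; rewrite !inE; have := h0 i; case: (sieving_prime h i) => //= /negbTE.
move/le_trans; apply; rewrite lerD2l.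
have bnd (D E : {set 'I_y.+1}) : D \in FF -> E \in FF ->
    (2 ^ #|D :|: E|)%:R / ((\prod_(i in D) g i) * (\prod_(i in E) g i)) <= (z * z)%:R :> R.
  rewrite !inE => /andP[Ds Dz] /andP[Es Ez]; rewrite !gprod //.
  have d0 := prod_gt0 _ Ds; have e0 := prod_gt0 _ Es.
  set d := (\prod_(i in D) i)%N in Dz d0 *; set e := (\prod_(i in E) i)%N in Ez e0 *.
  have -> : (2 ^ #|D|)%:R / d%:R * ((2 ^ #|E|)%:R / e%:R) = (2 ^ (#|D| + #|E|))%:R / (d * e)%:R :> R.
    by rewrite expnD !natrM invfM; ring.
  rewrite invf_div mulrA ler_pdivrMr ?ltr0n ?expn_gt0 // -!natrM ler_nat mulnC.
  apply: leq_mul; first exact: leq_mul.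
  by rewrite leq_exp2l // -cardsUI leq_addr.
apply: (@le_trans _ _ (\sum_(D in FF) \sum_(E in FF) (z * z)%:R)).
  by apply: ler_sum => D DF; apply: ler_sum => E EF; apply: bnd.
rewrite !sumr_const -!mulrnA ler_nat.
have c := card_sieve_family y h z.
by rewrite (_ : z ^ 4 = z * z * (z * z))%N; [rewrite !leq_mul|lia].
Qed.

(** * A lower bound for the mass of the sieve *)

Lemma ler_sum_inj (R : realFieldType) (I J : finType) (A : {set I}) (B : {set J})
    (f : I -> J) (v : J -> R) :
  {in A &, injective f} -> (forall i, i \in A -> f i \in B) -> (forall j, 0 <= v j) ->
  \sum_(i in A) v (f i) <= \sum_(j in B) v j.
Proof.
move=> finj fAB v0; rewrite -(big_imset _ finj) /=.
rewrite [leRHS](bigID (mem [set f x | x in A])) /=.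
rewrite [X in _ <= X + _](eq_bigl (mem [set f x | x in A])); last first.
  by move=> j /=; apply: andb_idl => /imsetP[i iA ->]; apply: fAB.
by rewrite lerDl sumr_ge0.
Qed.

Lemma sum_setX (R : nmodType) (I J : finType) (A : {set I}) (B : {set J})
    (v : I * J -> R) :
  \sum_(q in setX A B) v q = \sum_(i in A) \sum_(j in B) v (i, j).
Proof.
rewrite pair_big_dep /=; apply: eq_big => [[i j]|[i j] _ //].
by rewrite in_setX.
Qed.

Lemma sum_inv_square_le2 (R : realFieldType) n :
  \sum_(1 <= k < n.+1) (k%:R ^+ 2)^-1 <= 2 :> R.
Proof.
case: n => [|n]; first by rewrite big_geq.
suff : \sum_(1 <= k < n.+2) (k%:R ^+ 2)^-1 <= 2 - (n.+1)%:R^-1 :> R.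
  by move/le_trans; apply; rewrite lerBlDr lerDl invr_ge0.
elim: n => [|n IHn]; first by rewrite big_nat1 expr1n invr1; lra.
rewrite big_nat_recr //=; apply: le_trans (lerD IHn (lexx _)) _.
rewrite -[n.+2%:R]natr1; have : 0 < n.+1%:R :> R by rewrite ltr0n.
move: (n.+1%:R : R) => t t0; rewrite -subr_ge0.
have t1 : 0 < t + 1 by lra.
have -> : 2 - (t + 1)^-1 - (2 - t^-1 + ((t + 1) ^+ 2)^-1) = (t * (t + 1) ^+ 2)^-1.
  by field; rewrite !gt_eqF.
by rewrite invr_ge0 mulr_ge0 ?sqr_ge0 // ltW.
Qed.

Definition squarefree_family y : {set {set 'I_y.+1}} :=
  [set F : {set 'I_y.+1} | (F \subset (fun i : 'I_y.+1 => prime i)) &&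
                           (\prod_(i in F) i <= y)%N].

(** Write [n = s * k ^ 2] with [s] squarefree: since the sum of the inverse
    squares is bounded, squarefree numbers carry a positive proportion of the
    harmonic sum. *)
Lemma harmonic_le_squarefree (R : realFieldType) y :
  \sum_(1 <= n < y.+1) n%:R^-1 <=
  2 * \sum_(F in squarefree_family y) \prod_(i in F) (i%:R : R)^-1.
Proof.
pose Fs (n : nat) := [set i : 'I_y.+1 | prime i && odd (logn i n)].
pose ks (n : nat) := (\prod_(i < y.+1) i ^ (logn i n)./2)%N.
have dec n : (0 < n <= y)%N -> n = ((\prod_(i in Fs n) i) * ks n ^ 2)%N.
  move=> /andP[n0 ny]; rewrite -{1}(partnT n0) (widen_partn _ ny) big_mkord.
  rewrite /ks expnS expn1 -big_split [X in (_ = X * _)%N]big_mkcond -big_split /=.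
  apply: eq_bigr => i _; rewrite inE; case: (boolP (prime i)) => ip /=; last first.
    by rewrite lognE (negbTE ip) /= !expn0.
  rewrite -expnD addnn -{1}(odd_double_half (logn i n)) expnD.
  by case: odd.
have k0 n : (0 < n <= y)%N -> (0 < ks n)%N.
  by move=> ny; have := dec n ny; case: (ks n) => //; lia.
have F0 n : (0 < n <= y)%N -> (0 < \prod_(i in Fs n) i)%N.
  by move=> ny; have := dec n ny; case: (\prod_(i in _) _)%N => //; lia.
have Fy n : (0 < n <= y)%N -> (\prod_(i in Fs n) i <= y)%N.
  move=> ny; have := dec n ny; have := k0 n ny; nia.
have ky n : (0 < n <= y)%N -> (ks n <= y)%N.
  move=> ny; have := dec n ny; have := F0 n ny; have := k0 n ny.
  move: (ks n) (\prod_(i in _) _)%N => a b; nia.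
pose f (n : 'I_y.+1) : {set 'I_y.+1} * 'I_y.+1 := (Fs n, inord (ks n)).
pose v (q : {set 'I_y.+1} * 'I_y.+1) : R := \prod_(i in q.1) (i%:R)^-1 * (q.2%:R ^+ 2)^-1.
pose A : {set 'I_y.+1} := [set~ ord0].
have Ap (n : 'I_y.+1) : n \in A -> (0 < n <= y)%N.
  by rewrite !inE -val_eqE /= -lt0n => ->; rewrite -ltnS ltn_ord.
have := @ler_sum_inj R _ _ A (setX (squarefree_family y) A) f v.
have -> : \sum_(i in A) v (f i) = \sum_(1 <= n < y.+1) n%:R^-1.
  transitivity (\sum_(i in A) (i%:R : R)^-1).
    apply: eq_bigr => n /Ap ny; rewrite /v /f /= inordK ?ltnS ?ky //.
    rewrite [in RHS](dec n ny); move: (ks n) => k.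
    by rewrite prodfV -natr_prod -natrX -invfM -natrM.
  rewrite big_add1 /= big_mkord.
  rewrite (eq_bigl (fun i => i != ord0)) ?big_mkcond ?big_ord_recl /= ?add0r //.
  by move=> i; rewrite !inE.
have -> : \sum_(j in setX (squarefree_family y) A) v j = (\sum_(F in squarefree_family y) \prod_(i in F) (i%:R : R)^-1) *
     \sum_(1 <= k < y.+1) (k%:R ^+ 2)^-1.
  rewrite sum_setX big_distrlr /=.
  apply: eq_bigr => F _.
  rewrite big_add1 /= big_mkord.
  rewrite (eq_bigl (fun i => i != ord0)) ?big_mkcond ?big_ord_recl /= ?add0r //.
  by move=> i; rewrite !inE.
move=> h; have {h} h := h _ _ _; apply: le_trans (h _ _ _) _.
- move=> m n /Ap my /Ap ny [FF kk]; apply: val_inj; rewrite /= (dec m my) (dec n ny) FF.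
  by move/(congr1 val): kk; rewrite /= !inordK ?ltnS ?ky // => ->.
- move=> n /Ap ny; rewrite in_setX !inE Fy //= -!val_eqE /= inordK ?ltnS ?ky //.
  by rewrite -lt0n k0 // !andbT; apply/subsetP => i; rewrite inE => /andP[].
- by move=> q; rewrite mulr_ge0 ?invr_ge0 ?sqr_ge0 ?prodr_ge0 // => i; rewrite invr_ge0.
rewrite mulrC ler_wpM2r ?sum_inv_square_le2 //.
by apply: sumr_ge0 => F _; apply: prodr_ge0 => i _; rewrite invr_ge0.
Qed.

(** Two squarefree sums multiply into one over the unions: a prime of the union
    lies in one factor, in the other, or in both. *)
Lemma sum_union_prod (R : comPzRingType) (I : finType) (F : {set I}) (w : I -> R) :
  \sum_(A : {set I} | A \subset F) \sum_(B : {set I} | A :|: B == F)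
     (\prod_(i in A) w i) * (\prod_(i in B) w i) =
  \prod_(i in F) (w i * (2 + w i)).
Proof.
transitivity (\sum_(A : {set I} | A \subset F)
   (\prod_(i in F) w i) * \prod_(i in A) (1 + w i)).
  apply: eq_bigr => A AF; rewrite -big_distrr /=.
  rewrite (eq_bigl (fun B : {set I} => (F :\: A \subset B) && (B \subset F))).
    rewrite sum_between_prod ?subsetDl // setDDr setDv set0U (setIidPr AF) mulrA.
    by rewrite [in RHS](big_setID A) /= (setIidPr AF).
  move=> B; apply/eqP/andP => [<-|[FAB BF]].
    by rewrite subsetUr; split => //; rewrite subDset.
  by apply/eqP; rewrite eqEsubset subUset AF BF /= -subDset.
rewrite -big_distrr /= sum_subset_prod -big_split /=.
by apply: eq_bigr => i _; rewrite addrA.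
Qed.

(** Splitting off the primes that divide [2 * h] costs the product of the
    [1 + 1/p]. On the remaining primes the square of the squarefree harmonic sum up
    to [y] is at most the mass at level [y * y]: by [sum_union_prod] a prime gets
    the weight [(2 + 1/p) / p], which is at most [2 / (p - 2)], the quotient
    [g / (1 - g)] for [g = 2 / p]. *)
Lemma sieve_mass_lower (R : realFieldType) y h :
  (\sum_(1 <= n < y.+1) n%:R^-1) ^+ 2 <=
  4 * (\prod_(i < y.+1 | prime i && (i %| 2 * h)%N) (1 + i%:R^-1)) ^+ 2 *
  sieve_mass (pair_density R h) (sieve_family y h (y * y)).
Proof.
pose w (i : 'I_y.+1) : R := i%:R^-1.
have w0 i : 0 <= w i by rewrite invr_ge0.
have pw0 (D : {set 'I_y.+1}) : 0 <= \prod_(i in D) w i by apply: prodr_ge0.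
set H := \prod_(i < y.+1 | _) _.
have H0 : 0 <= H by apply: prodr_ge0 => i _; rewrite addr_ge0 // w0.
set S := \sum_(1 <= n < y.+1) _.
have S0 : 0 <= S by apply: sumr_ge0 => n _; rewrite invr_ge0.
pose T := \sum_(F in sieve_family y h y) \prod_(i in F) w i.
have T0 : 0 <= T by apply: sumr_ge0.
have ST : S <= 2 * (T * H).
  apply: le_trans (harmonic_le_squarefree R y) _; rewrite ler_pM2l //.
  pose Hs := [set i : 'I_y.+1 | prime i && (i %| 2 * h)%N].
  have -> : H = \sum_(A in powerset Hs) \prod_(i in A) w i.
    rewrite (eq_bigl (fun A : {set 'I_y.+1} => A \subset Hs)); last by move=> A; rewrite inE.
    by rewrite sum_subset_prod; apply: eq_bigl => i; rewrite inE.
  rewrite big_distrlr /=.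
  pose Ps := [set i : 'I_y.+1 | sieving_prime h i].
  pose f (F : {set 'I_y.+1}) := (F :&: Ps, F :\: Ps).
  pose v (q : {set 'I_y.+1} * {set 'I_y.+1}) : R := (\prod_(i in q.1) w i) * (\prod_(i in q.2) w i).
  set A := squarefree_family y.
  have := @ler_sum_inj R _ _ A (setX (sieve_family y h y) (powerset Hs)) f v.
  rewrite sum_setX /=.
  have -> : \sum_(i in A) v (f i) = \sum_(F in A) \prod_(i in F) w i.
    by apply: eq_bigr => F _; rewrite [in RHS](big_setID Ps).
  apply.
  - by move=> D E _ _ [e1 e2]; rewrite -(setID D Ps) e1 e2 setID.
  - move=> F; rewrite !inE => /andP[/subsetP Fp Fy] /=; apply/andP; split.
      apply/andP; split; first by apply/subsetP => i; rewrite !inE => /andP[].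
      apply: leq_trans Fy; rewrite [leqRHS](big_setID Ps) /= leq_pmulr //.
      by apply: prodn_cond_gt0 => i; rewrite inE => /andP[_ /Fp/prime_gt0].
    apply/subsetP => i; rewrite !inE => /andP[ip /Fp pr].
    have {}pr : prime i by [].
    move: ip; rewrite /sieving_prime pr /=.
    rewrite negb_and negbK => /orP[|ih]; last by rewrite dvdn_mull.
    case: (even_prime pr) => [-> _|-> //].
    exact: dvdn_mulr.
  - by move=> q; rewrite mulr_ge0.
suff TG : T ^+ 2 <= sieve_mass (pair_density R h) (sieve_family y h (y * y)).
  have -> : 4 * H ^+ 2 = (2 * H) ^+ 2 by rewrite exprMn; ring.
  apply: (@le_trans _ _ ((2 * H) ^+ 2 * T ^+ 2)).
    rewrite -exprMn; apply: lerXn2r; rewrite ?nnegrE ?mulr_ge0 //.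
    by rewrite -mulrA (mulrC H).
  by rewrite ler_wpM2l // sqr_ge0.
rewrite expr2 /T big_distrlr /= pair_big_dep /=.
set FF2 := sieve_family y h (y * y).
have subF z (F : {set 'I_y.+1}) i : F \in sieve_family y h z -> i \in F -> sieving_prime h i.
  by rewrite inE => /andP[/subsetP Fs _] /Fs.
rewrite (partition_big (fun q : {set 'I_y.+1} * {set 'I_y.+1} => q.1 :|: q.2) (mem FF2)) /=; last first.
  move=> [D E] /= /andP[DF EF]; rewrite inE; apply/andP; split.
    by apply/subsetP => i; rewrite inE => /orP[] ; [apply: subF DF|apply: subF EF].
  move: (DF) (EF); rewrite !inE => /andP[_ Dy] /andP[_ Ey].
  apply: leq_trans (leq_mul Dy Ey).
  rewrite [leqLHS](big_setID D) /= setUK setDUl setDv set0U leq_mul2l; apply/orP; right.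
  rewrite [leqRHS](big_setID D) /= leq_pmull //; apply: prodn_cond_gt0 => i.
  by rewrite inE => /andP[/(subF _ _ _ EF)/and3P[/prime_gt0]].
rewrite /sieve_mass; apply: ler_sum => F FF2F.
apply: (@le_trans _ _ (\prod_(i in F) (w i * (2 + w i)))).
  rewrite -sum_union_prod pair_big_dep /=.
  rewrite [leRHS](bigID (fun q : {set 'I_y.+1} * {set 'I_y.+1} =>
     (q.1 \in sieve_family y h y) && (q.2 \in sieve_family y h y))) /=.
  rewrite [X in X <= _](eq_bigl (fun q : {set 'I_y.+1} * {set 'I_y.+1} =>
     (q.1 \subset F) && (q.1 :|: q.2 == F) &&
     ((q.1 \in sieve_family y h y) && (q.2 \in sieve_family y h y)))); last first.
    move=> [D E] /=; rewrite andbC; case: eqP => [<-|]; rewrite ?andbF //=.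
    by rewrite subsetUl.
  by rewrite lerDl sumr_ge0 // => q _; rewrite mulr_ge0.
apply: ler_prod => i iF; rewrite mulr_ge0 ?addr_ge0 //=.
have is_ := subF _ _ _ FF2F iF.
rewrite /pair_density is_ /w.
have i3 : 3 <= i%:R :> R.
  rewrite ler_nat; case/and3P: is_ => ip io _; have := prime_gt1 ip.
  by case: (nat_of_ord i) io => [|[|[|]]].
move: (i%:R : R) i3 => t t3; have t0 : 0 < t by lra.
have t2 : 0 < t - 2 by lra.
have -> : 2 / t / (1 - 2 / t) = 2 / (t - 2) by field; rewrite !gt_eqF.
rewrite ler_pdivlMr //.
have -> : t^-1 * (2 + t^-1) * (t - 2) = 2 - (3 * t + 2) / t ^+ 2 by field; rewrite !gt_eqF.
by rewrite gerBl divr_ge0 ?sqr_ge0 //; lra.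
Qed.

(** * Differences of powers in a residue class *)

(** Modulo [e] the rows of exponents [0] and [b] of the Vandermonde matrix of
    [b + 1] solutions of [t ^ b = c] are proportional, so its determinant, the
    product of the differences, vanishes. *)
Lemma power_congr_dvd_differences b e c (t : nat -> nat) : (0 < b)%N -> (1 < e)%N ->
  {homo t : i j / (i < j)%N} ->
  (forall i, (i <= b)%N -> t i ^ b = c %[mod e])%N ->
  (e %| \prod_(i < b.+1) \prod_(j < b.+1 | (i < j)%N) (t j - t i))%N.
Proof.
move=> b0 e1 tinc tc.
have nat0 n : ((n%:R : 'Z_e) == 0) = (e %| n)%N.
  by rewrite -val_eqE /= val_Zp_nat.
pose a : 'rV['Z_e]_b.+1 := \row_j (t j)%:R.
have := det_Vandermonde a; set V := Vandermonde _ _ => detV.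
rewrite -nat0 natr_prod; apply/eqP; transitivity (\det V).
  rewrite detV; apply: eq_bigr => i _; rewrite natr_prod; apply: eq_bigr => j ij.
  by rewrite !mxE natrB // ltnW // tinc.
have natc (i : 'I_b.+1) : ((t i)%:R : 'Z_e) ^+ b = c%:R.
  by rewrite -natrX -(Zp_nat_mod e1) tc ?Zp_nat_mod //; apply: (ltn_ord i).
pose W : 'M['Z_e]_b.+1 := \matrix_(i, j) if i == ord_max then 1 else V i j.
have W0 : \det W = 0.
  apply: (determinant_alternate (i1 := ord0) (i2 := ord_max)).
    by rewrite -val_eqE /= eq_sym -lt0n.
  move=> j; rewrite !mxE eqxx; case: eqP => // _.
rewrite (determinant_multilinear (i0 := ord_max) (b := c%:R) (c := 0) (B := W) (C := W)).
- by rewrite W0 !mulr0 addr0.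
- by apply/rowP => j; rewrite !mxE eqxx mul0r addr0 mulr1 natc.
- by apply/matrixP => i j; rewrite !mxE eq_sym (negbTE (neq_lift _ _)).
- by apply/matrixP => i j; rewrite !mxE eq_sym (negbTE (neq_lift _ _)).
Qed.

(** If [b + 1] solutions lay in an interval of length [s], the product of their
    differences would be positive, divisible by [e], and smaller than
    [s ^ (b.+1 ^ 2)]. *)
Lemma power_congr_count_short b e c s u : (0 < b)%N -> (s ^ (b.+1 ^ 2) <= e)%N ->
  (count (fun t => t ^ b == c %[mod e])%N (iota u s) <= b)%N.
Proof.
move=> b0 se; rewrite leqNgt; apply/negP; rewrite -size_filter.
set l := [seq t <- _ | _] => bl.
have ls : sorted ltn l by apply: sorted_filter; [apply: ltn_trans|apply: iota_ltn_sorted].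
have lP i : (i <= b)%N -> (nth 0 l i ^ b == c %[mod e])%N && (u <= nth 0 l i < u + s)%N.
  move=> ib; have : nth 0%N l i \in l by rewrite mem_nth // (leq_ltn_trans ib).
  by rewrite mem_filter mem_iota.
have nth_lt i j : (i < j)%N -> (j <= b)%N -> (nth 0 l i < nth 0 l j)%N.
  move=> ij jb; apply: (sorted_ltn_nth ltn_trans) => //; rewrite inE.
    exact: ltn_trans ij (leq_ltn_trans jb bl).
  exact: leq_ltn_trans jb bl.
have s1 : (1 < s)%N.
  by have /andP[_ h0] := lP 0%N (leq0n b); have /andP[_ h1] := lP 1%N b0;
     have := nth_lt 0%N 1%N isT b0; lia.
have e1 : (1 < e)%N.
  apply: leq_trans se; rewrite -{1}(expn0 s) ltn_exp2l //.
pose t i := if (i <= b)%N then nth 0%N l i else (u + s + i)%N.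
have tinc : {homo t : i j / (i < j)%N}.
  move=> i j ij; rewrite /t; case: (leqP j b) => jb.
    by rewrite (leq_trans (ltnW ij) jb) nth_lt.
  case: (leqP i b) => ib; last by rewrite ltn_add2l.
  by have /andP[_ h] := lP i ib; lia.
have tc i : (i <= b)%N -> t i ^ b = c %[mod e].
  by move=> ib; rewrite /t ib; have /andP[/eqP] := lP i ib.
have := power_congr_dvd_differences b0 e1 tinc tc.
set V := (\prod_(i < _) _)%N.
have V0 : (0 < V)%N.
  apply: prodn_gt0 => i; apply: prodn_cond_gt0 => j ij.
  by rewrite subn_gt0 tinc.
move/(dvdn_leq V0); apply/negP; rewrite -ltnNge; apply: leq_trans se.
apply: (@leq_ltn_trans (s.-1 ^ (b.+1 ^ 2))); last first.
  by rewrite ltn_exp2r //; lia.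
apply: (@leq_trans (\prod_(i < b.+1) \prod_(j < b.+1) s.-1)); last first.
  by rewrite prod_nat_const prod_nat_const card_ord -expnM.
apply: leq_prod => i _; rewrite big_mkcond; apply: leq_prod => j _.
case: ifP => ij; last by lia.
have ib : (i <= b)%N by rewrite -ltnS.
have jb : (j <= b)%N by rewrite -ltnS.
rewrite /t ib jb; have /andP[_ h1] := lP i ib; have /andP[_ h2] := lP j jb; lia.
Qed.

Lemma power_congr_count b e c s J : (0 < b)%N -> (s ^ (b.+1 ^ 2) <= e)%N -> (s <= J)%N ->
  (s * count (fun t => t ^ b == c %[mod e])%N (iota 1 J) <= 2 * b * J)%N.
Proof.
move=> b0 se sJ; case: (posnP s) => [->//|s0].
have long q : (count (fun t => t ^ b == c %[mod e])%N (iota 1 (q * s)) <= q * b)%N.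
  elim: q => [|q IHq]; first by rewrite mul0n.
  by rewrite mulSnr iotaD count_cat mulSnr leq_add // power_congr_count_short.
have : (count (fun t => t ^ b == c %[mod e])%N (iota 1 J) <= (J %/ s).+1 * b)%N.
  apply: leq_trans (long _); rewrite -(subnKC (ltnW (ltn_ceil J s0))).
  by rewrite iotaD count_cat leq_addr.
have := leq_trunc_div J s; set q := (J %/ s)%N => qs h.
apply: leq_trans (leq_mul (leqnn s) h) _.
by nia.
Qed.

(** Fix [j] and cut the range of [i] into intervals of length [s]. If [s] exceeds
    [J], then [e] exceeds every difference [j ^ b - i ^ b] and nothing is
    counted. *)
Lemma power_difference_dvd_count b e s J : (0 < b)%N -> (s ^ (b.+1 ^ 2) <= e)%N ->
  (s * \sum_(j <- iota 1 J)
     count (fun i => (i < j) && (e %| j ^ b - i ^ b))%N (iota 1 J) <= 2 * b * J ^ 2)%N.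
Proof.
move=> b0 se; have [sJ|Js] := leqP s J; last first.
  rewrite big_seq big1 ?muln0 // => j; rewrite mem_iota => jJ.
  apply/eqP; rewrite -leqn0 leqNgt -has_count; apply/hasPn => i.
  rewrite mem_iota => iJ; apply/negP => /andP[ij /dvdn_leq].
  rewrite subn_gt0 ltn_exp2r // => /(_ ij) h.
  suff : (J ^ b < e)%N.
    have : (j ^ b <= J ^ b)%N by rewrite leq_exp2r //; lia.
    lia.
  apply: leq_trans se; apply: (@leq_trans (s ^ b)); first by rewrite ltn_exp2r.
  by rewrite leq_pexp2l //; [lia|nia].
rewrite big_distrr /=.
apply: (@leq_trans (\sum_(j <- iota 1 J) 2 * b * J)); last first.
  by rewrite big_const_seq count_predT size_iota iter_addn_0; nia.
apply: leq_sum => j _; apply: leq_trans (power_congr_count (j ^ b) b0 se sJ).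
rewrite leq_mul2l; apply/orP; right; apply: sub_count => i /= /andP[ij].
by rewrite -eqn_mod_dvd 1?eq_sym // leq_exp2r // ltnW.
Qed.

(** * Sums of inverses of primes *)

(** The primes between [2 ^ k] and [2 ^ k.+1] number at most [2 ^ k.+1 / k]. *)
Lemma prime_inverse_sum (R : realFieldType) I :
  \sum_(0 <= p < (2 ^ I).+1 | prime p) (p%:R : R)^-1 <= 1 + \sum_(1 <= k < I) 2 / k%:R.
Proof.
have two : \sum_(0 <= p < 3 | prime p) (p%:R : R)^-1 = 2^-1.
  by rewrite unlock /= addr0.
case: I => [|I].
  rewrite [X in _ + X]big_geq // addr0.
  apply: (@le_trans _ _ (\sum_(0 <= p < 3 | prime p) (p%:R : R)^-1)); last by rewrite two; lra.
  rewrite [leRHS](@big_cat_nat _ _ _ 2) //= lerDl.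
  by apply: sumr_ge0 => p _; rewrite invr_ge0.
elim: I => [|I IHI].
  by rewrite [X in _ + X]big_geq // addr0 two; lra.
rewrite (@big_cat_nat _ _ _ (2 ^ I.+1).+1) //=; last by rewrite ltnS leq_exp2l.
rewrite big_nat_recr //= addrA; apply: lerD IHI _.
have := prime_count_dyadic I.+1; set m := (2 ^ I.+1)%N => cnt.
have m0 : (0 < m)%N by rewrite expn_gt0.
apply: (@le_trans _ _ (\sum_(m.+1 <= p < (2 ^ I.+2).+1 | prime p) (m%:R : R)^-1)).
  rewrite big_nat_cond [leRHS]big_nat_cond; apply: ler_sum => p /andP[/andP[mp _] _].
  by rewrite lef_pV2 ?posrE ?ltr0n ?ler_nat //; lia.
have -> : \sum_(m.+1 <= p < (2 ^ I.+2).+1 | prime p) (m%:R : R)^-1 =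
   (prime_count m.+1 (2 ^ I.+2).+1)%:R / m%:R.
  rewrite /prime_count natr_sum big_distrl /=; apply: eq_bigr => p _.
  by rewrite mul1r.
rewrite ler_pdivrMr ?ltr0n // mulrAC ler_pdivlMr ?ltr0n //.
rewrite -natrM -natrM ler_nat mulnC; apply: leq_trans cnt _.
by rewrite expnS.
Qed.

(** The terms with [k <= k0] are at most [1] and the others at most [1 / k0]; with
    [k0] fixed but large this is a [o (I)] without logarithms. *)
Lemma harmonic_upper (R : realFieldType) k0 I : (0 < k0)%N ->
  \sum_(1 <= k < I) (k%:R : R)^-1 <= k0%:R + I%:R / k0%:R.
Proof.
move=> k00; elim: I => [|I IHI].
  by rewrite big_geq // mul0r addr0.
case: I IHI => [|I] IHI.
  by rewrite big_geq // addr_ge0 // divr_ge0.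
rewrite big_nat_recr //=; case: (ltnP I.+1 k0) => Ik.
  apply: (@le_trans _ _ (I.+1)%:R); last first.
    by rewrite ler_wpDr ?divr_ge0 // ler_nat ltnW.
  rewrite -big_nat_recr //=; have -> : I.+1%:R = \sum_(1 <= k < I.+2) 1 :> R.
    by rewrite sumr_const_nat subn1.
  rewrite big_nat [leRHS]big_nat; apply: ler_sum => k /andP[k1 _].
  by rewrite invf_le1 ?ltr0n // ler1n.
rewrite -[I.+2%:R]natr1 mulrDl mul1r addrA; apply: lerD IHI _.
by rewrite lef_pV2 ?posrE ?ltr0n // ler_nat.
Qed.

Lemma ler_sum_sub_seq (R : realFieldType) (I : eqType) (s1 s2 : seq I) (v : I -> R) :
  uniq s1 -> uniq s2 -> {subset s1 <= s2} -> (forall i, 0 <= v i) ->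
  \sum_(i <- s1) v i <= \sum_(i <- s2) v i.
Proof.
move=> u1 u2 s12 v0; rewrite [leRHS](bigID (mem s1)) /= -[X in _ <= X + _]big_filter.
rewrite (perm_big [seq i <- s2 | mem s1 i]) ?lerDl ?sumr_ge0 //=.
apply: uniq_perm; rewrite ?filter_uniq // => i.
by rewrite mem_filter /=; apply/esym; apply: andb_idr => /s12.
Qed.

(** Primes up to [2 ^ I] fall under [prime_inverse_sum]; the others contribute at
    most [2 ^- I] each. *)
Lemma prime_set_inverse_sum (R : realFieldType) (s : seq nat) I k0 :
  uniq s -> all prime s -> (size s <= 2 ^ I)%N -> (0 < k0)%N ->
  \sum_(p <- s) (p%:R : R)^-1 <= 2 + 2 * (k0%:R + I%:R / k0%:R).
Proof.
move=> us sp sI k00.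
rewrite (bigID (fun p => (p < (2 ^ I).+1)%N)) /=.
have h1 : \sum_(p <- s | (p < (2 ^ I).+1)%N) (p%:R : R)^-1 <=
    1 + 2 * (k0%:R + I%:R / k0%:R).
  apply: (@le_trans _ _ (\sum_(0 <= p < (2 ^ I).+1 | prime p) (p%:R : R)^-1)).
    rewrite -big_filter -[leRHS]big_filter; apply: ler_sum_sub_seq.
    - by rewrite filter_uniq.
    - by rewrite filter_uniq ?iota_uniq.
    - by move=> p; rewrite !mem_filter mem_index_iota => /andP[-> /(allP sp) ->].
    - by move=> p; rewrite invr_ge0.
  apply: le_trans (prime_inverse_sum R I) _; rewrite lerD2l.
  rewrite -big_distrr /= ler_pM2l //; exact: harmonic_upper.
have h2 : \sum_(p <- s | ~~ (p < (2 ^ I).+1)%N) (p%:R : R)^-1 <= 1.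
  apply: (@le_trans _ _ (\sum_(p <- s) ((2 ^ I)%:R : R)^-1)).
    rewrite [leRHS](bigID (fun p => (p < (2 ^ I).+1)%N)) /= ler_wpDl //.
      by apply: sumr_ge0 => p _; rewrite invr_ge0.
    apply: ler_sum => p pI.
    by rewrite lef_pV2 ?posrE ?ltr0n ?ler_nat ?expn_gt0 //; lia.
  rewrite big_const_seq count_predT iter_addr_0 -[_ *+ size s]mulr_natl ler_pdivrMr ?ltr0n ?expn_gt0 //.
  by rewrite mul1r ler_nat.
lra.
Qed.

(** * The order of [a] modulo primes, on average *)

Lemma exp2_size_primes n : (0 < n)%N -> (2 ^ size (primes n) <= n)%N.
Proof.
move=> n0; apply: (@leq_trans (\prod_(p <- primes n) p)).
  have : all prime (primes n) by apply/allP => p; rewrite mem_primes => /andP[].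
  elim: (primes n) => [|p s IHs] /=; first by rewrite big_nil.
  by move=> /andP[pp /IHs sp]; rewrite big_cons expnS leq_mul // prime_gt1.
apply: dvdn_leq => //; apply: prod_primes_dvd; first exact: primes_uniq.
  by apply/allP => p; rewrite mem_primes => /andP[].
by move=> p; rewrite mem_primes => /and3P[].
Qed.

Lemma sum_primes_swap (R : nmodType) (v : nat -> R) (P : pred nat) m n :
  (0 < m)%N -> (0 < n)%N ->
  \sum_(p <- primes m | (p %| n)%N && P p) v p =
  \sum_(p <- primes n | (p %| m)%N && P p) v p.
Proof.
move=> m0 n0; rewrite -big_filter -[RHS]big_filter; apply: perm_big.
apply: uniq_perm; rewrite ?filter_uniq ?primes_uniq // => p.
rewrite !mem_filter !mem_primes m0 n0 /=.
by case: (prime p); case: (p %| m)%N; case: (p %| n)%N; case: (P p).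
Qed.

Lemma order_exists a p m : (0 < a)%N -> (0 < m)%N -> (p %| a ^ m - 1)%N ->
  exists e, [/\ (0 < e)%N, (p %| a ^ e - 1)%N &
    forall n, (p %| a ^ n - 1)%N -> (e %| n)%N].
Proof.
move=> a0 m0 pm.
have congr n : (p %| a ^ n - 1)%N = (a ^ n == 1 %[mod p])%N.
  by rewrite eqn_mod_dvd // expn_gt0 a0.
have ex : exists e, (0 < e)%N && (p %| a ^ e - 1)%N by exists m; rewrite m0.
case: (ex_minnP ex) => e /andP[e0 pe] emin; exists e; split => // n pn.
rewrite /dvdn; case: (posnP (n %% e)%N) => [//|r0].
have := emin (n %% e)%N; rewrite r0 /= congr.
have -> : a ^ (n %% e) = 1 %[mod p].
  have an : (a ^ n = (a ^ e) ^ (n %/ e) * a ^ (n %% e))%N.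
    by rewrite -expnM -expnD mulnC -divn_eq.
  move: pn pe; rewrite !congr an => /eqP pn /eqP pe.
  by rewrite -pn -modnMml -(modnXm _ _ (a ^ e)%N) pe modnXm exp1n modnMml mul1n.
by rewrite eqxx => /(_ isT); have := ltn_pmod n e0; lia.
Qed.

(** The primes dividing [order_product a E] are those modulo which [a] has order
    below [E]. *)
Definition order_product a E := (\prod_(1 <= e < E) (a ^ e - 1))%N.

Lemma order_product_gt0 a E : (1 < a)%N -> (0 < order_product a E)%N.
Proof.
move=> a1; rewrite /order_product big_nat; apply: prodn_cond_gt0 => e /andP[e0 _].
by rewrite subn_gt0 -{1}(expn0 a) ltn_exp2l.
Qed.

Lemma order_product_dvd a E E' : (E <= E')%N -> (order_product a E %| order_product a E')%N.
Proof.
case: E => [|E] EE; first by rewrite /order_product big_geq.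
by rewrite /order_product (@big_cat_nat _ _ _ E.+1 1 E') //= dvdn_mulr.
Qed.

Lemma power_minus1_dvd_order_product a E m : (0 < m < E)%N ->
  (a ^ m - 1 %| order_product a E)%N.
Proof.
move=> mE; rewrite /order_product (big_rem m) /=; first exact: dvdn_mulr.
by rewrite mem_index_iota.
Qed.

Lemma order_ge_of_ndvd a E e p : (0 < e)%N -> (p %| a ^ e - 1)%N ->
  ~~ (p %| order_product a E)%N -> (E <= e)%N.
Proof.
move=> e0 pe; apply: contraR; rewrite -ltnNge => eE.
by apply: dvdn_trans pe _; apply: power_minus1_dvd_order_product; rewrite e0.
Qed.

Lemma size_primes_order_product a E I : (1 < a)%N -> (E <= 2 ^ I)%N ->
  (size (primes (order_product a E)) <= 2 ^ (a + 2 * I))%N.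
Proof.
move=> a1 EI; have := exp2_size_primes (order_product_gt0 E a1).
have : (order_product a E <= 2 ^ (a * (E * E)))%N.
  apply: (@leq_trans (\prod_(1 <= e < E) 2 ^ (a * E))).
    rewrite /order_product big_nat [leqRHS]big_nat; apply: leq_prod => e /andP[e0 eE].
    apply: (@leq_trans (a ^ e)); first by rewrite leq_subr.
    apply: (@leq_trans ((2 ^ a) ^ e)); first by rewrite leq_exp2r // ltnW // ltn_expl.
    by rewrite -expnM leq_exp2l // leq_mul2l ltnW ?orbT.
  rewrite prod_nat_const_nat -expnM leq_exp2l //; nia.
move=> h1 h2; have := leq_trans h2 h1; rewrite leq_exp2l // => h.
apply: leq_trans h _; rewrite expnD mulnC expnM mulnC; apply: leq_mul.
  by rewrite ltnW // ltn_expl.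
by rewrite -expnM mulnC expnM expnS expn1 leq_mul.
Qed.

(** Suppose [S] climbs from [0] by steps [u i] and stays below [M i]. Let [i] be
    the last index with [u i >= 2 ^- i.+1]: the later steps add at most [1], so
    [expR (C * S K)] is at most [expR (C * M i) * expR C], and the factor
    [2 ^+ i.+1 * u i >= 1] may be inserted. The result is linear in [u], hence
    can be averaged. *)
Lemma expR_sum_le (R : realType) (C : R) (S M u : nat -> R) K :
  0 <= C -> S 0%N = 0 -> (forall i, 0 <= u i) -> (forall i, S i.+1 = S i + u i) ->
  (forall i, S i.+1 <= M i) ->
  expR (C * S K) <= expR C * (1 + \sum_(i < K) 2 ^+ i.+1 * expR (C * M i) * u i).
Proof.
move=> C0 S0 u0 SS SM.
suff h : expR (C * S K) <= expR (C * (1 - (2 ^+ K)^-1)) *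
    (1 + \sum_(i < K) 2 ^+ i.+1 * expR (C * M i) * u i).
  apply: le_trans h _; rewrite ler_wpM2r //.
    by rewrite addr_ge0 // sumr_ge0 // => i _; rewrite !mulr_ge0 ?expR_ge0 ?exprn_ge0.
  by rewrite ler_expR ler_piMr // gerBl invr_ge0 exprn_ge0.
elim: K => [|K IHK].
  by rewrite big_ord0 S0 mulr0 expR0 addr0 mulr1 expr0 invr1 subrr mulr0 expR0.
rewrite big_ord_recr /=; set T := \sum_(i < K) _ in IHK *.
have T0 : 0 <= T.
  by rewrite sumr_ge0 // => i _; rewrite !mulr_ge0 ?expR_ge0 ?exprn_ge0.
have p0 : 0 < 2 ^+ K :> R by rewrite exprn_gt0.
have [us|ub] := leP (u K) ((2 ^+ K.+1)^-1).
  apply: (@le_trans _ _ (expR (C * (1 - (2 ^+ K.+1)^-1)) * (1 + T))).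
    rewrite SS mulrDr expRD.
    have -> : C * (1 - (2 ^+ K.+1)^-1) = C * (1 - (2 ^+ K)^-1) + C * (2 ^+ K.+1)^-1.
      by rewrite exprS; field; rewrite gt_eqF.
    rewrite expRD mulrAC; apply: ler_pM; rewrite ?expR_ge0 //.
    by rewrite ler_expR ler_wpM2l.
  rewrite ler_wpM2l ?expR_ge0 // lerD2l lerDl.
  by rewrite !mulr_ge0 ?expR_ge0 ?exprn_ge0.
apply: (@le_trans _ _ (expR (C * M K))); first by rewrite ler_expR ler_wpM2l.
apply: (@le_trans _ _ (1 + (T + 2 ^+ K.+1 * expR (C * M K) * u K))).
  have h : expR (C * M K) <= 2 ^+ K.+1 * expR (C * M K) * u K.
    rewrite mulrAC ler_peMl ?expR_ge0 //.
    rewrite mulrC -ler_pdivrMr ?exprn_gt0 // mul1r.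
    exact: ltW.
  lra.
rewrite ler_peMl //.
  by rewrite addr_ge0 // addr_ge0 // !mulr_ge0 ?expR_ge0 ?exprn_ge0.
rewrite -[leLHS]expR0 ler_expR mulr_ge0 // subr_ge0 invf_le1 ?exprn_gt0 //.
by rewrite exprn_ege1 // ler1n.
Qed.

(** The order [e] of [a] modulo [p] is at least [(16 ^ i) ^ (b.+1 ^ 2)], so
    [power_difference_dvd_count] applies to [e] with [s = 16 ^ i]. *)
Lemma power_minus1_dvd_count a b p i J : (1 < a)%N -> (0 < b)%N ->
  ~~ (p %| order_product a ((16 ^ i) ^ (b.+1 ^ 2)))%N ->
  (16 ^ i * \sum_(j <- iota 1 J)
     count (fun k => (k < j) && (p %| a ^ (j ^ b - k ^ b) - 1)) (iota 1 J)
   <= 2 * b * J ^ 2)%N.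
Proof.
move=> a1 b0 pQ.
case: (pselect (exists m, (0 < m)%N /\ (p %| a ^ m - 1)%N)) => [[m [m0 pm]]|np].
  have [e [e0 pe ord_e]] := order_exists (ltnW a1) m0 pm.
  apply: leq_trans (power_difference_dvd_count J b0 (order_ge_of_ndvd e0 pe pQ)).
  rewrite leq_mul2l; apply/orP; right; apply: leq_sum => j _.
  by apply: sub_count => k /= /andP[-> /ord_e].
rewrite big1 ?muln0 // => j _; apply/eqP; rewrite -leqn0 leqNgt -has_count.
apply/hasPn => k _; apply/negP => /andP[kj pjk]; apply: np.
by exists (j ^ b - k ^ b)%N; rewrite subn_gt0 ltn_exp2r.
Qed.

(** The average of [expR (C * \sum_(p | a ^ m - 1) 1/p)] over the differences
    [m = j ^ b - i ^ b] is bounded. The primes are cut into levels according to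
    the order of [a]: level [i] is rarely hit (a proportion [16 ^- i] of the
    pairs), while the sum of [1/p] up to level [i] is only [o(i)]. *)
Lemma average_exp_prime_inverse_sum (R : realType) (a b : nat) (C : R) :
  (1 < a)%N -> (0 < b)%N -> 1 <= C ->
  exists K : R, 0 < K /\ forall J,
    \sum_(j <- iota 1 J) \sum_(i <- iota 1 J | (i < j)%N)
      expR (C * \sum_(p <- primes (a ^ (j ^ b - i ^ b) - 1)) p%:R^-1) <= K * (J ^ 2)%:R.
Proof.
move=> a1 b0 C1; have a0 : (0 < a)%N by apply: ltnW.
have C0 : 0 <= C by apply: le_trans C1.
pose B := (b.+1 ^ 2)%N; pose E i := ((16 ^ i) ^ B)%N.
pose I i := (a + 2 * (4 * i.+1 * B))%N.
have EI i : (E i.+1 <= 2 ^ (4 * i.+1 * B))%N. 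
  rewrite /E; have -> : 16%N = (2 ^ 4)%N by [].
  by rewrite -!expnM mulnA.
(* with this [k0] the bound [C * M i] grows at most like [i / 2], and
   [expR (1 / 2) <= 2] *)
pose k0 := (Num.truncn (32 * B%:R * C)).+1.
have k0P : 32 * B%:R * C <= k0%:R.
  by apply/ltW/truncnS_gt.
have k00 : 0 < k0%:R :> R by rewrite ltr0n.
pose M i : R := 2 + 2 * (k0%:R + (I i)%:R / k0%:R).
pose D : R := expR (C * (2 + 2 * (k0%:R + (a + 8 * B)%:R / k0%:R))).
have D0 : 0 < D by apply: expR_gt0.
have D0' := ltW D0.
have CM i : expR (C * M i) <= D * 2 ^+ i.
  have h2 : expR (2^-1) <= 2 :> R.
    have := expR_ge1Dx (- 2^-1 : R); rewrite expRN => h.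
    rewrite -[2 in leRHS]invrK -[leLHS]invrK lef_pV2 ?posrE ?invr_gt0 ?expR_gt0 //.
    by apply: le_trans h; lra.
  apply: (@le_trans _ _ (D * expR (2^-1) ^+ i)); last first.
    by rewrite ler_wpM2l ?(ltW D0) // lerXn2r ?nnegrE ?expR_ge0.
  rewrite -expRM_natl -expRD ler_expR.
  have -> : C * M i = C * (2 + 2 * (k0%:R + (a + 8 * B)%:R / k0%:R)) + i%:R * (16 * B%:R * C / k0%:R).
    rewrite /M /I !natrD !natrM -natr1; field; exact: lt0r_neq0.
  rewrite lerD2l ler_wpM2l // ler_pdivrMr //; lra.
have MD i : M i <= D * 2 ^+ i.
  apply: le_trans (CM i).
  have M0 : 0 <= M i by rewrite /M addr_ge0 // mulr_ge0 // addr_ge0 // divr_ge0.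
  apply: (@le_trans _ _ (C * M i)); first by rewrite ler_peMl.
  by apply: le_trans (expR_ge1Dx _); rewrite lerDr.
exists (expR C * (1 + 8 * b%:R * D ^+ 2)); split.
  by rewrite mulr_gt0 ?expR_gt0 // ltr_pwDl // !mulr_ge0.
move=> J; pose Q i := order_product a (E i).
have Q0 i : (0 < Q i)%N by apply: order_product_gt0.
have QM i (P : pred nat) : \sum_(p <- primes (Q i.+1) | P p) (p%:R : R)^-1 <= M i.
  rewrite -big_filter; apply: prime_set_inverse_sum => //.
  - by rewrite filter_uniq ?primes_uniq.
  - by apply/allP => p; rewrite mem_filter mem_primes => /and3P[].
  rewrite size_filter; apply: leq_trans (count_size _ _) _.
  exact: size_primes_order_product.
pose u m i : R := \sum_(p <- primes (Q i.+1) | (p %| a ^ m - 1)%N && ~~ (p %| Q i)%N) p%:R^-1.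
(* levels from [J] on are empty: there the order exceeds every exponent *)
pose K := J; pose W i : R := 2 ^+ i.+1 * expR (C * M i).
have step m : (0 < m <= J ^ b)%N ->
    expR (C * \sum_(p <- primes (a ^ m - 1)) p%:R^-1) <=
    expR C * (1 + \sum_(i < K) W i * u m i).
  move=> /andP[m0 mJ].
  have am0 : (0 < a ^ m - 1)%N by rewrite subn_gt0 -{1}(expn0 a) ltn_exp2l.
  pose S i : R := \sum_(p <- primes (a ^ m - 1) | (p %| Q i)%N) p%:R^-1.
  have -> : \sum_(p <- primes (a ^ m - 1)) p%:R^-1 = S K.
    rewrite /S big_seq [RHS]big_seq_cond; apply: eq_bigl => p.
    rewrite mem_primes; case: (boolP (p %| a ^ m - 1)%N); rewrite ?andbF // => pm.
    rewrite (dvdn_trans pm) ?andbT // /Q.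
    apply: power_minus1_dvd_order_product; rewrite m0 /=.
    apply: leq_ltn_trans mJ _; apply: (@leq_ltn_trans (J ^ B)).
      rewrite /B; case: (posnP J) => [->|J0]; first by rewrite exp0n // .
      by rewrite leq_pexp2l //; nia.
    have B0 : (0 < B)%N by rewrite expn_gt0.
    rewrite /E (ltn_exp2r _ _ B0); exact: ltn_expl.
  apply: expR_sum_le => //.
  - rewrite /S /Q /E expn0 exp1n /order_product big_geq // big_seq_cond big1 // => p.
    by rewrite dvdn1 mem_primes => /andP[/and3P[pp _ _] /eqP p1]; rewrite p1 in pp.
  - by move=> i; apply: sumr_ge0 => p _; rewrite invr_ge0.
  - move=> i; rewrite /S (bigID (fun p => p %| Q i)%N) /=; congr (_ + _).
      apply: eq_bigl => p; apply: andb_idl => /dvdn_trans; apply.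
      by apply: order_product_dvd; rewrite /E leq_exp2r // leq_exp2l.
    exact: sum_primes_swap.
  - move=> i; rewrite /S; under eq_bigl do rewrite -[(_ %| _)%N]andbT.
    by rewrite (sum_primes_swap _ xpredT).
have ucount i : \sum_(j <- iota 1 J) \sum_(k <- iota 1 J | (k < j)%N) u (j ^ b - k ^ b)%N i <=
    M i * ((2 * b * J ^ 2)%:R / 16 ^+ i).
  have -> : \sum_(j <- iota 1 J) \sum_(k <- iota 1 J | (k < j)%N) u (j ^ b - k ^ b)%N i =
     \sum_(p <- primes (Q i.+1) | ~~ (p %| Q i)%N) p%:R^-1 *
       (\sum_(j <- iota 1 J)
          count (fun k => (k < j) && (p %| a ^ (j ^ b - k ^ b) - 1))%N (iota 1 J))%:R.
    under [RHS]eq_bigr => p _ do rewrite natr_sum big_distrr.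
    rewrite exchange_big; apply: eq_bigr => j _.
    transitivity (\sum_(k <- iota 1 J | (k < j)%N)
        \sum_(p <- primes (Q i.+1) | ~~ (p %| Q i)%N)
          (p%:R : R)^-1 * (p %| a ^ (j ^ b - k ^ b) - 1)%N%:R).
      apply: eq_bigr => k _; rewrite /u big_mkcond [RHS]big_mkcond.
      apply: eq_bigr => p _; case: (_ %| _ - 1)%N; case: (_ %| _)%N => //=.
        by rewrite mulr1.
      by rewrite mulr0.
    rewrite exchange_big; apply: eq_bigr => p _ /=.
    rewrite -big_distrr; congr (_ * _).
    rewrite -sum1_count natr_sum big_mkcond [RHS]big_mkcond.
    by apply: eq_bigr => k _; case: (k < j)%N; case: (_ %| _)%N.
  apply: (@le_trans _ _ (\sum_(p <- primes (Q i.+1) | ~~ (p %| Q i)%N)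
      p%:R^-1 * ((2 * b * J ^ 2)%:R / 16 ^+ i))).
    rewrite big_seq_cond [leRHS]big_seq_cond; apply: ler_sum => p.
    rewrite mem_primes => /andP[/and3P[pp _ _] pQ].
    rewrite ler_wpM2l ?invr_ge0 // ler_pdivlMr ?exprn_gt0 // -natrX -natrM ler_nat mulnC.
    exact: power_minus1_dvd_count.
  by rewrite -big_distrl /= ler_wpM2r ?divr_ge0 ?exprn_ge0.
apply: (@le_trans _ _ (\sum_(j <- iota 1 J) \sum_(k <- iota 1 J | (k < j)%N)
    expR C * (1 + \sum_(i < K) W i * u (j ^ b - k ^ b)%N i))).
  rewrite big_seq [leRHS]big_seq; apply: ler_sum => j; rewrite mem_iota => jJ.
  rewrite big_seq_cond [leRHS]big_seq_cond; apply: ler_sum => k /andP[_ kj].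
  apply: step; rewrite subn_gt0 ltn_exp2r // kj /=.
  by apply: leq_trans (leq_subr _ _) _; rewrite leq_exp2r //; lia.
under eq_bigr => j _ do rewrite -big_distrr big_split /=.
rewrite -big_distrr big_split /= -mulrA ler_wpM2l ?expR_ge0 // mulrDl mul1r; apply: lerD.
  apply: (@le_trans _ _ (\sum_(j <- iota 1 J) J%:R)).
    apply: ler_sum => j _.
    have -> : \sum_(k <- iota 1 J | (k < j)%N) 1 = (count (fun k => k < j)%N (iota 1 J))%:R :> R.
      by rewrite -sum1_count natr_sum.
    by rewrite ler_nat; apply: leq_trans (count_size _ _) _; rewrite size_iota.
  by rewrite -natr_sum ler_nat big_const_seq count_predT size_iota iter_addn_0 -mulnn.
have -> : \sum_(j <- iota 1 J) \sum_(k <- iota 1 J | (k < j)%N)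
      \sum_(i < K) W i * u (j ^ b - k ^ b)%N i =
    \sum_(i < K) W i * \sum_(j <- iota 1 J) \sum_(k <- iota 1 J | (k < j)%N)
      u (j ^ b - k ^ b)%N i.
  under eq_bigr => j _ do rewrite exchange_big.
  rewrite exchange_big; apply: eq_bigr => i _; rewrite big_distrr; apply: eq_bigr => j _.
  by rewrite big_distrr.
apply: (@le_trans _ _ (\sum_(i < K) (4 * b%:R * D ^+ 2 * (J ^ 2)%:R) * (2^-1) ^+ i)).
  apply: ler_sum => i _.
  apply: (@le_trans _ _ (W i * (M i * ((2 * b * J ^ 2)%:R / 16 ^+ i)))).
    by rewrite ler_wpM2l // /W mulr_ge0 ?expR_ge0 ?exprn_ge0.
  apply: (@le_trans _ _ (2 ^+ i.+1 * (D * 2 ^+ i) * ((D * 2 ^+ i) * ((2 * b * J ^ 2)%:R / 16 ^+ i)))).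
    rewrite /W; apply: ler_pM.
    - by rewrite mulr_ge0 ?expR_ge0 ?exprn_ge0.
    - by rewrite mulr_ge0 ?divr_ge0 ?exprn_ge0 // addr_ge0 // mulr_ge0 // addr_ge0 // divr_ge0.
    - by rewrite ler_wpM2l ?exprn_ge0.
    - by rewrite ler_wpM2r ?divr_ge0 ?exprn_ge0.
  have -> : 16 ^+ i = (2 ^+ i) ^+ 4 :> R by rewrite -exprM mulnC exprM; congr (_ ^+ _); ring.
  rewrite exprS exprVn !natrM; have := exprn_gt0 i (ltr0Sn R 1).
  move: (2 ^+ i) => t t0; rewrite le_eqVlt; apply/orP; left; apply/eqP.
  by field; rewrite gt_eqF.
rewrite -big_distrr /=.
have -> : 8 * b%:R * D ^+ 2 * (J ^ 2)%:R = 4 * b%:R * D ^+ 2 * (J ^ 2)%:R * 2 :> R by ring.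
rewrite ler_wpM2l ?mulr_ge0 ?sqr_ge0 //.
suff : \sum_(i < K) 2^-1 ^+ i <= 2 - 2 * 2^-1 ^+ K :> R.
  by move/le_trans; apply; rewrite gerBl mulr_ge0 ?exprn_ge0.
elim: (K) => [|n IHn]; first by rewrite big_ord0 expr0; lra.
rewrite big_ord_recr /= exprS; lra.
Qed.

(** * Prime pairs *)

Lemma harmonic_lower (R : realFieldType) u :
  u%:R / 2 <= \sum_(1 <= n < (2 ^ u).+1) (n%:R : R)^-1.
Proof.
elim: u => [|u IHu]; first by rewrite mul0r sumr_ge0 // => n _; rewrite invr_ge0.
rewrite (@big_cat_nat _ _ _ (2 ^ u).+1) //=; last by rewrite ltnS leq_exp2l.
rewrite -natr1 mulrDl; apply: lerD IHu _; rewrite mul1r.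
have -> : 2^-1 = \sum_((2 ^ u).+1 <= n < (2 ^ u.+1).+1) ((2 ^ u.+1)%:R : R)^-1.
  rewrite sumr_const_nat subSS expnS mul2n -addnn addnK addnn -mul2n natrM.
  rewrite -[_ *+ _]mulr_natl; field.
  by rewrite pnatr_eq0 -lt0n expn_gt0.
rewrite [leLHS]big_nat [leRHS]big_nat; apply: ler_sum => n /andP[n0 n1].
by rewrite lef_pV2 ?posrE ?ltr0n ?expn_gt0 ?ler_nat //; lia.
Qed.

Lemma prod_one_plus_inverse_le (R : realType) y n : (0 < n)%N ->
  \prod_(i < y.+1 | prime i && (i %| n)%N) (1 + i%:R^-1) <=
  expR (\sum_(p <- primes n) p%:R^-1) :> R.
Proof.
move=> n0; apply: (@le_trans _ _ (expR (\sum_(i < y.+1 | prime i && (i %| n)%N) i%:R^-1))).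
  rewrite expR_sum; apply: ler_prod => i _.
  by rewrite addr_ge0 ?invr_ge0 //= expR_ge1Dx.
rewrite ler_expR -(big_mkord (fun i => prime i && (i %| n)%N) (fun i => i%:R^-1)).
rewrite -big_filter; apply: ler_sum_sub_seq.
- by rewrite filter_uniq ?iota_uniq.
- exact: primes_uniq.
- by move=> p; rewrite mem_filter mem_primes n0 => /andP[].
- by move=> p; rewrite invr_ge0.
Qed.

(** The sieve at level [y = 2 ^ u] with [u] about [L / 16], which makes the
    remainder [y ^ 8] at most the square root of [2 ^ L]. *)
Lemma prime_pair_count_upper (R : realType) L h : (0 < h)%N ->
  (count (fun n => prime n && prime (n + h)) (iota 0 (2 ^ L).+1))%:R * L%:R ^+ 2 <=
  35 * 32 ^+ 2 * 2 ^+ L * expR (2 * \sum_(p <- primes (2 * h)) p%:R^-1) :> R.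
Proof.
move=> h0; set c := count _ _; set Ex := expR _.
have Ex1 : 1 <= Ex.
  rewrite /Ex -[leLHS]expR0 ler_expR; apply: mulr_ge0 => //.
  by apply: sumr_ge0 => p _; rewrite invr_ge0.
have t0 : 0 < 2 ^+ L :> R by rewrite exprn_gt0.
have cN : c%:R <= 2 * 2 ^+ L :> R.
  have : (c <= (2 ^ L).+1)%N by apply: leq_trans (count_size _ _) _; rewrite size_iota.
  rewrite -(ler_nat R) -natr1 natrX => h1; apply: le_trans h1 _.
  have : 1 <= 2 ^+ L :> R by rewrite exprn_ege1 // ler1n.
  lra.
pose u := (L %/ 16)%N.
have Lu : (L < u.+1 * 16)%N by rewrite ltn_ceil.
have uL : (u * 16 <= L)%N by rewrite leq_trunc_div.
have [u0|u0] := posnP u.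
  apply: (@le_trans _ _ (2 * 2 ^+ L * 16 ^+ 2)).
    apply: ler_pM; [exact: ler0n|exact: sqr_ge0|exact: cN|].
    by rewrite lerXn2r ?nnegrE // ler_nat; rewrite u0 in Lu; apply: ltnW.
  apply: (@le_trans _ _ (35 * 32 ^+ 2 * 2 ^+ L * 1)); first by lra.
  by rewrite ler_wpM2l // !mulr_ge0 // ltW.
pose y := (2 ^ u)%N; pose z := (y * y)%N.
have y0 : (0 < y)%N by rewrite expn_gt0.
have z0 : (0 < z)%N by rewrite muln_gt0 y0.
pose G : R := sieve_mass (pair_density R h) (sieve_family y h z).
pose H : R := \prod_(i < y.+1 | prime i && (i %| 2 * h)%N) (1 + i%:R^-1).
have HE : H ^+ 2 <= Ex.
  rewrite /Ex mulrC mulr_natr mulr2n expRD -expr2 lerXn2r ?nnegrE ?expR_ge0 //.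
    by apply: prodr_ge0 => i _; rewrite addr_ge0 ?invr_ge0.
  by apply: prod_one_plus_inverse_le; rewrite muln_gt0.
have GH : u%:R ^+ 2 <= 16 * H ^+ 2 * G.
  have := sieve_mass_lower R y h; rewrite -/H -/G.
  have : (u%:R / 2) ^+ 2 <= (\sum_(1 <= n < y.+1) n%:R^-1) ^+ 2 :> R.
    by rewrite lerXn2r ?nnegrE ?divr_ge0 ?harmonic_lower // sumr_ge0 // => n _; rewrite invr_ge0.
  move=> a b; have := le_trans a b; rewrite exprMn exprVn; lra.
have ur0 : 0 < u%:R :> R by rewrite ltr0n.
have H0 : 0 <= H ^+ 2 by apply: sqr_ge0.
have G0 : 0 < G.
  rewrite ltNge; apply/negP => G0.
  have : 16 * H ^+ 2 * G <= 0 by apply: mulr_ge0_le0 => //; apply: mulr_ge0.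
  by move/(le_trans GH); rewrite leNgt exprn_gt0.
have sift : c%:R <= y%:R + 1 + ((2 ^ L).+1%:R / G + (z ^ 4)%:R) :> R.
  pose P n := [forall i : 'I_y.+1, sieving_prime h i ==> ~~ (i %| n * (n + h))%N].
  have : (c <= y.+1 + count P (iota 0 (2 ^ L).+1))%N.
    apply: (@leq_trans (count (predU (fun n => n < y.+1)%N P) (iota 0 (2 ^ L).+1))).
      apply: sub_count => n /= /andP[np nhp].
      have [//|yn /=] := ltnP n y.+1.
      apply/forallP => i; apply/implyP => /and3P[ip _ _].
      have iy : (i < y.+1)%N by [].
      rewrite Euclid_dvdM // !dvdn_prime2 // negb_or !neq_ltn (leq_trans iy yn).
      by rewrite (leq_trans iy (leq_trans yn (leq_addr h n))).
    apply: leq_trans (leq_addr (count (predI (fun n => n < y.+1)%N P) (iota 0 (2 ^ L).+1)) _) _.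
    rewrite count_predUI leq_add2r.
    have : (count (fun n => n < y.+1) (iota 0 (2 ^ L).+1) <= y.+1)%N.
      rewrite -size_filter; apply: (@leq_trans (size (iota 0 y.+1))); last by rewrite size_iota.
      apply: uniq_leq_size; first by rewrite filter_uniq ?iota_uniq.
      by move=> n; rewrite mem_filter !mem_iota => /andP[].
    by [].
  rewrite -(ler_nat R) natrD -natr1 => /le_trans; apply; rewrite lerD2l.
  exact: prime_pair_sieve.
(* [L < 16 * (u + 1) <= 32 * u] turns [u] back into [L] *)
have L32 : L%:R <= 32 * u%:R :> R by rewrite -natrM ler_nat; move: Lu u0; clear; lia.
have L2 : L%:R ^+ 2 <= 32 ^+ 2 * u%:R ^+ 2 :> R.
  have -> : 32 ^+ 2 * u%:R ^+ 2 = (32 * u%:R) ^+ 2 :> R by rewrite exprMn.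
  by rewrite lerXn2r ?nnegrE ?mulr_ge0.
have main : (2 ^ L).+1%:R / G * L%:R ^+ 2 <= 32 * 32 ^+ 2 * 2 ^+ L * Ex.
  apply: (@le_trans _ _ (2 * 2 ^+ L / G * (32 ^+ 2 * (16 * H ^+ 2 * G)))).
    apply: ler_pM; rewrite ?sqr_ge0 ?divr_ge0 ?(ltW G0) //.
      rewrite ler_wpM2r ?invr_ge0 ?(ltW G0) // -natr1 natrX.
      have : 1 <= 2 ^+ L :> R by rewrite exprn_ege1 // ler1n.
      lra.
    by apply: le_trans L2 _; rewrite ler_wpM2l.
  have -> : 2 * 2 ^+ L / G * (32 ^+ 2 * (16 * H ^+ 2 * G)) = 32 * 32 ^+ 2 * 2 ^+ L * H ^+ 2.
    by field; rewrite gt_eqF.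
  by rewrite ler_wpM2l // !mulr_ge0 // ltW.
have err : (y%:R + 1 + (z ^ 4)%:R) * L%:R ^+ 2 <= 3 * 32 ^+ 2 * 2 ^+ L :> R.
  have yz : y%:R + 1 + (z ^ 4)%:R <= 3 * (z ^ 4)%:R :> R.
    rewrite natr1 -natrD -natrM ler_nat.
    have : (y <= z ^ 4)%N by rewrite /z mulnn -expnM -{1}(expn1 y) leq_pexp2l.
    have : (0 < z ^ 4)%N by rewrite expn_gt0 z0.
    by clear; move: (z ^ 4)%N => t; lia.
  apply: (@le_trans _ _ (3 * (z ^ 4)%:R * (32 ^+ 2 * (z ^ 4)%:R))).
    apply: ler_pM; [by rewrite !addr_ge0|exact: sqr_ge0|exact: yz|].
    apply: le_trans L2 _; rewrite ler_wpM2l // -natrX ler_nat.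
    have uy : (u <= y)%N by rewrite ltnW // ltn_expl.
    apply: (@leq_trans (y ^ 2)); first by rewrite leq_exp2r.
    by rewrite /z mulnn -expnM leq_pexp2l.
  have -> : 3 * (z ^ 4)%:R * (32 ^+ 2 * (z ^ 4)%:R) = 3 * 32 ^+ 2 * (2 ^ (u * 16))%:R :> R.
    have -> : (2 ^ (u * 16) = z ^ 4 * z ^ 4)%N.
      by rewrite -expnD /z mulnn -expnM /y -expnM.
    by rewrite natrM; ring.
  by rewrite ler_wpM2l // -natrX ler_nat leq_exp2l.
apply: (@le_trans _ _ ((y%:R + 1 + ((2 ^ L).+1%:R / G + (z ^ 4)%:R)) * L%:R ^+ 2)).
  by rewrite ler_wpM2r ?sqr_ge0.
have -> : (y%:R + 1 + ((2 ^ L).+1%:R / G + (z ^ 4)%:R)) * L%:R ^+ 2 =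
   (y%:R + 1 + (z ^ 4)%:R) * L%:R ^+ 2 + (2 ^ L).+1%:R / G * L%:R ^+ 2 :> R by ring.
apply: le_trans (lerD err main) _.
have e1 : 3 * 32 ^+ 2 * 2 ^+ L <= 3 * 32 ^+ 2 * 2 ^+ L * Ex.
  by rewrite ler_peMr // !mulr_ge0 // ltW.
apply: le_trans (lerD e1 (lexx _)) _.
by rewrite le_eqVlt; apply/orP; left; apply/eqP; ring.
Qed.

(** * Collisions between sums of a prime and a power *)

(** Cauchy-Schwarz: a map with few collisions has a large image. *)
Lemma image_collision_bound (T : eqType) (t : seq T) (f : T -> nat) :
  (size t ^ 2 <= size (undup (map f t)) * \sum_(x <- t) \sum_(y <- t) (f x == f y))%N.
Proof.
set V := undup _; pose c v := (\sum_(x <- t) (f x == v))%N.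
have one x : x \in map f t -> (\sum_(v <- V) (x == v) = 1)%N.
  rewrite -mem_undup -/V => xV.
  rewrite (bigD1_seq x) ?undup_uniq //= eqxx big1 // => v.
  by rewrite eq_sym => /negbTE ->.
have inmap (F : T -> nat) (G : T -> nat) :
    (forall x, f x \in map f t -> F x = G x) -> (\sum_(x <- t) F x = \sum_(x <- t) G x)%N.
  move=> FG; rewrite big_seq [RHS]big_seq; apply: eq_bigr => x xt.
  by apply: FG; apply: map_f.
have sz : (\sum_(v <- V) c v = size t)%N.
  rewrite exchange_big /= (inmap _ (fun=> 1%N)); last by move=> x /one.
  by rewrite sum1_size.
have sq : (\sum_(v <- V) c v ^ 2 = \sum_(x <- t) \sum_(y <- t) (f x == f y))%N.
  transitivity (\sum_(x <- t) \sum_(y <- t) \sum_(v <- V) (f x == v) * (f y == v))%N.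
    under [RHS]eq_bigr do rewrite exchange_big.
    rewrite exchange_big; apply: eq_bigr => v _.
    by rewrite expnS expn1 big_distrlr.
  apply: (@inmap) => x fx; apply: (@inmap) => y fy.
  case: eqVneq => [->|nxy].
    by rewrite -[RHS](one _ fy); apply: eq_bigr => v _; case: eqP.
  rewrite big1 // => v _; case: (eqVneq (f x) v) => [<-|//].
  by rewrite eq_sym (negbTE nxy).
rewrite -sz -sq -(leq_pmul2l (isT : (0 < 2)%N)) expnS expn1 big_distrlr big_distrr /=.
apply: (@leq_trans (\sum_(v <- V) \sum_(w <- V) (c v ^ 2 + c w ^ 2))).
  apply: leq_sum => v _; rewrite big_distrr; apply: leq_sum => w _.
  exact: (nat_Cauchy (c v) (c w)).1.
rewrite (eq_bigr (fun v => size V * c v ^ 2 + \sum_(w <- V) c w ^ 2))%N; last first.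
  move=> v _; rewrite big_split /= big_const_seq count_predT iter_addn_0 mulnC.
  by [].
rewrite big_split /= -big_distrr big_const_seq count_predT iter_addn_0 /=.
by rewrite mulnCA mul2n -addnn; lia.
Qed.

Definition primes_upto n := [seq p <- iota 0 n.+1 | prime p].

Lemma size_primes_upto n : size (primes_upto n) = prime_count 0 n.+1.
Proof. by rewrite size_filter /prime_count sum1_count /index_iota subn0. Qed.

Definition prime_power_sums a b n J :=
  undup [seq (q.1 + a ^ (q.2 ^ b))%N | q <- [seq (p, j) | p <- primes_upto n, j <- iota 1 J]].

Lemma sum_primes_mul_le (R : realFieldType) m n : (0 < m)%N -> (0 < n)%N ->
  \sum_(p <- primes (m * n)) (p%:R : R)^-1 <=
  \sum_(p <- primes m) p%:R^-1 + \sum_(p <- primes n) p%:R^-1.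
Proof.
move=> m0 n0; rewrite (bigID (fun p => p %| m)%N) /=.
rewrite -[X in X + _ <= _]big_filter -[X in _ + X <= _]big_filter; apply: lerD.
  apply: ler_sum_sub_seq; rewrite ?filter_uniq ?primes_uniq // => p.
  by rewrite mem_filter !mem_primes m0 => /and3P[-> -> _].
apply: ler_sum_sub_seq; rewrite ?filter_uniq ?primes_uniq // => p.
rewrite mem_filter !mem_primes n0 => /and4P[pm pp _].
by rewrite pp Euclid_dvdM // (negbTE pm).
Qed.

(** Representations [p + a ^ (j ^ b)] with [p <= 2 ^ L] and [j <= J]: the second
    moment is within a constant of the first, because the sieve loses only
    [expR (2 * \sum_(p | 2 * h) 1/p)] for the difference [h] of two powers, and
    this is bounded on average. *)
Lemma prime_power_sums_lower (R : realType) (a b : nat) : (1 < a)%N -> (0 < b)%N ->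
  exists c : R, 0 < c /\ forall L J, (0 < J)%N -> (J <= L)%N ->
    c * 2 ^+ L * J%:R <= L%:R * (size (prime_power_sums a b (2 ^ L) J))%:R.
Proof.
move=> a1 b0; have a0 := ltnW a1.
have [K [K0 avg]] := @average_exp_prime_inverse_sum R a b 2 a1 b0 (ler1n _ 2).
pose ca : R := expR (2 * \sum_(p <- primes (2 * a)) p%:R^-1).
pose A : R := 35 * 32 ^+ 2 * ca * K.
have ca0 : 0 < ca by apply: expR_gt0.
have A0 : 0 < A by rewrite !mulr_gt0 // exprn_gt0.
exists ((4 * (6 + 2 * A))^-1); split; first by rewrite invr_gt0; lra.
move=> L J J0 JL; set s := primes_upto (2 ^ L); set V := prime_power_sums _ _ _ _.
have L0 : (0 < L)%N by apply: leq_trans JL.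
have Lr : 0 < L%:R :> R by rewrite ltr0n.
have Jr : 0 < J%:R :> R by rewrite ltr0n.
have t0 : 0 < 2 ^+ L :> R by rewrite exprn_gt0.
pose B j := (a ^ (j ^ b))%N.
pose N j k := (\sum_(p <- s) \sum_(q <- s) (p + B j == q + B k))%N.
have us : uniq s by rewrite filter_uniq ?iota_uniq.
have mem_count x : (\sum_(q <- s) (x == q) <= (x \in s))%N.
  case: (boolP (x \in s)) => xs.
    rewrite (bigD1_seq x) //= eqxx big1 // => q.
    by rewrite eq_sym => /negbTE ->.
  by rewrite big_seq big1 // => q qs; case: eqP => // xq; rewrite xq qs in xs.
have Ndiag j : (N j j <= size s)%N.
  rewrite /N -sum1_size; apply: leq_sum => p _.
  under eq_bigr do rewrite eqn_add2r.
  by apply: leq_trans (mem_count p) _; case: (p \in s).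
have Nsym j k : N j k = N k j.
  by rewrite /N exchange_big; apply: eq_bigr => p _; apply: eq_bigr => q _; rewrite eq_sym.
have Noff j k : (0 < k < j)%N -> (N j k)%:R * L%:R ^+ 2 <=
    35 * 32 ^+ 2 * ca * 2 ^+ L * expR (2 * \sum_(p <- primes (a ^ (j ^ b - k ^ b) - 1)) p%:R^-1).
  move=> /andP[k0 kj]; have kjb : (k ^ b < j ^ b)%N by rewrite ltn_exp2r.
  have Bkj : (B k < B j)%N by rewrite ltn_exp2l.
  pose h := (B j - B k)%N; have h0 : (0 < h)%N by rewrite subn_gt0.
  have hE : h = (a ^ (k ^ b) * (a ^ (j ^ b - k ^ b) - 1))%N.
    by rewrite mulnBr muln1 -expnD subnKC // ltnW.
  have am0 : (0 < a ^ (j ^ b - k ^ b) - 1)%N.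
    by rewrite subn_gt0 -{1}(expn0 a) ltn_exp2l // subn_gt0.
  apply: (@le_trans _ _ (35 * 32 ^+ 2 * 2 ^+ L * expR (2 * \sum_(p <- primes (2 * h)) p%:R^-1))).
    apply: le_trans (prime_pair_count_upper R L h0); rewrite ler_wpM2r ?sqr_ge0 // ler_nat.
    rewrite /N -sum1_count.
    apply: (@leq_trans (\sum_(p <- s) (prime (p + h)))).
      apply: leq_sum => p _.
      have e q : (p + B j == q + B k)%N = (p + h == q)%N.
        by rewrite /h -[RHS](eqn_add2r (B k)) -addnA subnK // ltnW.
      under eq_bigr do rewrite e.
      apply: leq_trans (mem_count (p + h)%N) _; rewrite /s mem_filter.
      by case: (prime _); case: (_ \in _).
    rewrite /s /primes_upto big_filter; move: (iota _ _) => l.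
    rewrite [leqLHS]big_mkcond [leqRHS]big_mkcond /=; apply: leq_sum => p _.
    by case: prime; case: prime.
  have -> : 35 * 32 ^+ 2 * ca * 2 ^+ L * expR (2 * \sum_(p <- primes (a ^ (j ^ b - k ^ b) - 1)) p%:R^-1) =
     35 * 32 ^+ 2 * 2 ^+ L * (ca * expR (2 * \sum_(p <- primes (a ^ (j ^ b - k ^ b) - 1)) p%:R^-1)) by ring.
  rewrite ler_wpM2l ?(ltW t0) // ?mulr_ge0 ?exprn_ge0 //.
  rewrite /ca -expRD ler_expR -mulrDr ler_pM2l //.
  have -> : (2 * h = 2 * a ^ (k ^ b) * (a ^ (j ^ b - k ^ b) - 1))%N by rewrite hE mulnA.
  apply: le_trans (sum_primes_mul_le R _ am0) _; first by rewrite muln_gt0 expn_gt0 a0.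
  rewrite lerD2r; apply: ler_sum_sub_seq; rewrite ?primes_uniq // => p.
  rewrite !mem_primes !muln_gt0 expn_gt0 a0 /= => /andP[pp].
  by rewrite pp !Euclid_dvdM // Euclid_dvdX // => /orP[->//|/andP[-> _]]; rewrite orbT.
pose t := [seq (p, j) | p <- s, j <- iota 1 J].
pose f (q : nat * nat) := (q.1 + B q.2)%N.
have coll : (\sum_(x <- t) \sum_(y <- t) (f x == f y) =
             \sum_(j <- iota 1 J) \sum_(k <- iota 1 J) N j k)%N.
  rewrite /t big_allpairs_dep /=.
  under eq_bigr do under eq_bigr do rewrite big_allpairs_dep.
  rewrite exchange_big; apply: eq_bigr => j _; rewrite /N [RHS]exchange_big.
  by apply: eq_bigr => p _; rewrite [RHS]exchange_big.
have offsum : (\sum_(j <- iota 1 J) \sum_(k <- iota 1 J | (k < j)%N) (N j k)%:R) * L%:R ^+ 2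
    <= A * 2 ^+ L * J%:R ^+ 2.
  apply: (@le_trans _ _ (\sum_(j <- iota 1 J) \sum_(k <- iota 1 J | (k < j)%N)
     35 * 32 ^+ 2 * ca * 2 ^+ L *
       expR (2 * \sum_(p <- primes (a ^ (j ^ b - k ^ b) - 1)) p%:R^-1))).
    rewrite big_distrl; apply: ler_sum => j _; rewrite big_distrl big_seq_cond.
    rewrite [leRHS]big_seq_cond; apply: ler_sum => k /andP[kJ kj].
    by apply: Noff; rewrite kj andbT; move: kJ; rewrite mem_iota => /andP[].
  under eq_bigr do rewrite -big_distrr.
  rewrite -big_distrr /=.
  have -> : A * 2 ^+ L * J%:R ^+ 2 = 35 * 32 ^+ 2 * ca * 2 ^+ L * (K * (J ^ 2)%:R).
    by rewrite /A natrX; ring.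
  by rewrite ler_wpM2l // !mulr_ge0 // ltW.
have split : (\sum_(j <- iota 1 J) \sum_(k <- iota 1 J) N j k <=
    J * size s + 2 * \sum_(j <- iota 1 J) \sum_(k <- iota 1 J | (k < j)%N) N j k)%N.
  have -> : (\sum_(j <- iota 1 J) \sum_(k <- iota 1 J) N j k =
     \sum_(j <- iota 1 J) N j j
     + (\sum_(j <- iota 1 J) \sum_(k <- iota 1 J | (k < j)%N) N j k
     + \sum_(j <- iota 1 J) \sum_(k <- iota 1 J | (j < k)%N) N j k))%N.
    rewrite -big_split -big_split big_seq [RHS]big_seq /=; apply: eq_bigr => j jJ.
    rewrite (bigD1_seq j) ?iota_uniq //=; congr (_ + _)%N.
    rewrite (bigID (fun k => k < j)%N) /=; congr (_ + _)%N; apply: eq_bigl => k.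
      by rewrite ltn_neqAle; case: (k == j).
    by rewrite -leqNgt ltn_neqAle eq_sym.
  apply: leq_add.
    apply: (@leq_trans (\sum_(j <- iota 1 J) size s)); first by apply: leq_sum.
    by rewrite big_const_seq count_predT size_iota iter_addn_0 mulnC.
  rewrite mul2n -addnn leq_add2l (exchange_big_dep xpredT) //=.
  by apply: leq_sum => j _; apply: leq_sum => k _; rewrite Nsym.
have CS : (size s * J)%:R ^+ 2 <= (size V)%:R *
    (J%:R * (size s)%:R + 2 * \sum_(j <- iota 1 J) \sum_(k <- iota 1 J | (k < j)%N) (N j k)%:R) :> R.
  have := image_collision_bound t f; rewrite coll size_allpairs size_iota => h.
  have -> : J%:R * (size s)%:R + 2 * \sum_(j <- iota 1 J) \sum_(k <- iota 1 J | (k < j)%N) (N j k)%:R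
     = (J * size s + 2 * \sum_(j <- iota 1 J) \sum_(k <- iota 1 J | (k < j)%N) N j k)%:R :> R.
    rewrite natrD !natrM natr_sum; congr (_ + _ * _).
    by apply: eq_bigr => j _; rewrite natr_sum.
  rewrite -natrX -natrM ler_nat.
  exact: leq_trans h (leq_mul (leqnn _) split).
set P2 := \sum_(j <- _) _ in CS offsum.
have up : (size s)%:R * L%:R <= 6 * 2 ^+ L :> R.
  rewrite -natrM -natrX -natrM ler_nat mulnC /s size_primes_upto.
  exact: prime_count_upper.
have lo : 2 ^+ L <= 2 * ((size s)%:R * L%:R) :> R.
  rewrite -natrM -natrX -natrM ler_nat /s size_primes_upto.
  case: (L) L0 => // L' _; rewrite {1}expnS leq_pmul2l // mulnC.
  exact: prime_count_lower.
set S := (size s)%:R in CS up lo *; set v := (size V)%:R in CS *.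
have JLr : J%:R <= L%:R :> R by rewrite ler_nat.
have v0 : 0 <= v by [].
have S0 : 0 <= S by [].
(* multiply the Cauchy-Schwarz inequality by [L ^ 2] *)
have key : (S * L%:R * J%:R) ^+ 2 <= v * ((6 + 2 * A) * 2 ^+ L * J%:R * L%:R).
  have -> : (S * L%:R * J%:R) ^+ 2 = (size s * J)%:R ^+ 2 * L%:R ^+ 2.
    by rewrite natrM; ring.
  apply: le_trans (ler_wpM2r (sqr_ge0 _) CS) _.
  rewrite -(mulrA v); apply: ler_wpM2l => //; rewrite mulrDl.
  have -> : (6 + 2 * A) * 2 ^+ L * J%:R * L%:R =
     J%:R * L%:R * (6 * 2 ^+ L) + 2 * (A * 2 ^+ L * (J%:R * L%:R)) by ring.
  apply: lerD.
    have -> : J%:R * S * L%:R ^+ 2 = J%:R * L%:R * (S * L%:R) by ring.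
    by rewrite ler_wpM2l ?mulr_ge0.
  rewrite -mulrA ler_pM2l //; apply: le_trans offsum _.
  have JJ : J%:R ^+ 2 <= J%:R * L%:R :> R by rewrite expr2; apply: ler_wpM2l.
  by apply: ler_wpM2l JJ; apply: mulr_ge0; apply: ltW.
have A6 : 0 < 6 + 2 * A by lra.
rewrite -mulrA ler_pdivrMl ?mulr_gt0 //.
have h4 : (2 ^+ L * J%:R) ^+ 2 <= 4 * (S * L%:R * J%:R) ^+ 2.
  have -> : 4 * (S * L%:R * J%:R) ^+ 2 = (2 * (S * L%:R) * J%:R) ^+ 2 by ring.
  by rewrite lerXn2r ?nnegrE ?mulr_ge0 ?(ltW t0) // ler_wpM2r.
have h5 := le_trans h4 (ler_wpM2l (ler0n _ 4) key).
have tJ : 0 < 2 ^+ L * J%:R :> R by apply: mulr_gt0.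
rewrite -(ler_pM2l tJ) -expr2; apply: le_trans h5 _.
by rewrite le_eqVlt; apply/orP; left; apply/eqP; ring.
Qed.

(** * Passage to the real variable *)

Lemma leq_count_prime_plus_power (R : realType) a b (x : R) (V : seq nat) : uniq V ->
  (forall n, n \in V -> prime_plus_power_upto a b x n) ->
  (size V <= count_prime_plus_power a b x)%N.
Proof.
move=> uV VA; apply: uniq_leq_size => // n /VA An.
by rewrite in_fset_set ?mem_set //; apply: finite_prime_plus_power_upto.
Qed.

Lemma count_prime_plus_power_leq (R : realType) a b (x : R) (V : seq nat) :
  (forall n, prime_plus_power_upto a b x n -> n \in V) ->
  (count_prime_plus_power a b x <= size V)%N.
Proof.
move=> AV; apply: uniq_leq_size; first exact: fset_uniq.
move=> n; rewrite in_fset_set; last exact: finite_prime_plus_power_upto.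
by move/set_mem/AV.
Qed.

Lemma nat_root_exists b n : (0 < b)%N -> exists J, (J ^ b <= n < J.+1 ^ b)%N.
Proof.
move=> b0.
have ex : exists J, (J ^ b <= n)%N by exists 0%N; rewrite exp0n.
have bd J : (J ^ b <= n)%N -> (J <= n)%N.
  by move/(leq_trans _); apply; case: J => // J; rewrite -{1}(expn1 J.+1) leq_pexp2l.
case: (ex_maxnP ex bd) => J Jn Jmax; exists J; rewrite Jn ltnNge.
by apply/negP => /Jmax; rewrite ltnn.
Qed.

Lemma ln2_bounds (R : realType) : 2^-1 <= ln (2 : R) <= 1.
Proof.
have ln2 : expR (ln 2) = 2 :> R by rewrite lnK // posrE.
apply/andP; split; rewrite -ler_expR ln2; last first.
  by apply: le_trans (expR_ge1Dx 1); lra.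
have := expR_ge1Dx (- 2^-1 : R); rewrite expRN => h.
rewrite -[2 in leRHS]invrK -[leLHS]invrK lef_pV2 ?posrE ?invr_gt0 ?expR_gt0 //.
by apply: le_trans h; lra.
Qed.

Lemma ln_between_powers_of_two (R : realType) (x : R) L : (0 < L)%N ->
  2 ^+ L <= x -> x <= 2 ^+ L.+1 -> L%:R / 2 <= ln x <= 2 * L%:R.
Proof.
move=> L0 Lx xL; have /andP[l2 l2'] := ln2_bounds R.
have t0 n : 0 < 2 ^+ n :> R by rewrite exprn_gt0.
have x0 : 0 < x by apply: lt_le_trans Lx.
have L1 : 1 <= L%:R :> R by rewrite ler1n.
have h1 : L%:R * ln 2 <= ln x.
  by rewrite mulr_natl -lnXn // ler_ln ?posrE.
have h2 : ln x <= L.+1%:R * ln 2.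
  by rewrite mulr_natl -lnXn // ler_ln ?posrE.
have h3 : L%:R * 2^-1 <= L%:R * ln 2 :> R by rewrite ler_wpM2l.
have h4 : L.+1%:R * ln 2 <= L.+1%:R :> R by rewrite ler_piMr.
move: h4; rewrite -natr1 => h4; rewrite -natr1 in h2.
by apply/andP; split; lra.
Qed.

Theorem theorem1p9 (R : realType) (a b : nat) (ha : (2 <= a)%N) (hb : (2 <= b)%N) :
  exists c1 c2 : R, [/\ 0 < c1, 0 < c2
    & forall x : R, 3 <= x ->
      c1 * (x / (ln x `^ (1 - 1 / b%:R)))
        <= (count_prime_plus_power a b x)%:R
        <= c2 * (x / (ln x `^ (1 - 1 / b%:R)))].
Proof.
have b0 : (0 < b)%N by apply: ltnW.
have a0 : (0 < a)%N by apply: ltnW.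
have [c [c0 low]] := prime_power_sums_lower R ha b0.
have ar : 0 < a%:R :> R by rewrite ltr0n.
pose c1a : R := c / (32 * a%:R); pose c1b : R := (2 ^+ a.+2)^-1.
have c1a0 : 0 < c1a by rewrite divr_gt0 // mulr_gt0.
have c1b0 : 0 < c1b by rewrite invr_gt0 exprn_gt0.
exists (Num.min c1a c1b), 72; split => //; first by rewrite lt_min c1a0.
move=> x x3; have x0 : 0 < x by lra.
pose L := trunc_log 2 (Num.truncn x).
have xt1 : (3 <= Num.truncn x)%N by rewrite truncn_ge_nat // ltW.
have xt0 : (0 < Num.truncn x)%N by apply: leq_trans xt1.
have L0 : (0 < L)%N by rewrite trunc_log_gt0 /=; apply: leq_trans xt1.
have Lx : 2 ^+ L <= x.
  by rewrite -natrX -truncn_ge_nat ?(ltW x0) // trunc_logP.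
have xL : x < 2 ^+ L.+1.
  by rewrite -natrX -truncn_lt_nat ?(ltW x0) // trunc_log_ltn.
have Lr : 1 <= L%:R :> R by rewrite ler1n.
set l := ln x.
have /andP[lL Ll] := ln_between_powers_of_two L0 Lx (ltW xL); rewrite -/l in lL Ll.
have l0 : 0 < l by lra.
have l12 : 2^-1 <= l by lra.
pose v := l `^ (1 / b%:R).
have br : b%:R != 0 :> R by rewrite pnatr_eq0 -lt0n.
have v0 : 0 < v by apply: powR_gt0.
have vb : v ^+ b = l.
  rewrite -powR_mulrn ?(ltW v0) // -powRrM mul1r mulVf // powRr1 //; exact: ltW.
have -> : x / l `^ (1 - 1 / b%:R) = x * v / l.
  rewrite powRB; last by apply/implyP => _; rewrite gt_eqF.
  by rewrite powRr1 ?(ltW l0) // invf_div mulrA.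
have le_root (u w : R) : 0 <= u -> 0 <= w -> u ^+ b <= w ^+ b -> u <= w.
  by move=> u0 w0; rewrite ler_pXn2r.
have le_pow (n : nat) : (0 < n)%N -> n%:R <= n%:R ^+ b :> R.
  by move=> n0; rewrite -natrX ler_nat -{1}(expn1 n) leq_pexp2l.
have xvl0 : 0 <= x * v / l by rewrite divr_ge0 ?mulr_ge0 // ltW.
apply/andP; split; last first.
  (* [J] is the largest exponent that can occur: [2 ^ (j ^ b) <= a ^ (j ^ b)] *)
  have [J /andP[JL LJ]] := nat_root_exists L.+1 b0.
  pose V := [seq (q.1 + a ^ (q.2 ^ b))%N | q <- [seq (p, j) | p <- primes_upto (2 ^ L.+1), j <- iota 0 J.+1]].
  have cV : (count_prime_plus_power a b x <= size V)%N.
    apply: count_prime_plus_power_leq => n [n1 nx [p [j [pp pj]]]].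
    have nL : (n < 2 ^ L.+1)%N.
      by rewrite -(ltr_nat R) natrX; apply: le_lt_trans xL.
    apply/mapP; exists (p, j) => //; apply: allpairs_f.
      rewrite mem_filter pp mem_iota add0n ltnS /=.
      by apply: leq_trans (ltnW nL); rewrite -pj leq_addr.
    rewrite mem_iota add0n leq0n andTb ltnS leqNgt; apply/negP => Jj.
    have : (L.+1 < j ^ b)%N by apply: leq_trans LJ _; rewrite leq_exp2r.
    move=> Ljb; have : (2 ^ L.+1 < a ^ (j ^ b))%N.
      apply: (@leq_trans (2 ^ (j ^ b))); first by rewrite ltn_exp2l.
      by rewrite leq_exp2r // (leq_trans _ Ljb).
    have an : (a ^ (j ^ b) <= n)%N by rewrite -pj leq_addl.
    by move/(ltn_trans (leq_ltn_trans an nL)); rewrite ltnn.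
  have sV : (size V)%:R = (size (primes_upto (2 ^ L.+1)))%:R * J.+1%:R :> R.
    by rewrite size_map size_allpairs size_iota natrM.
  set S := (size (primes_upto _))%:R in sV.
  have Sl : S * l <= 12 * x.
    have : S * L.+1%:R <= 6 * 2 ^+ L.+1.
      rewrite -natrM -natrX -natrM ler_nat mulnC size_primes_upto.
      exact: prime_count_upper.
    have S0 : 0 <= S by [].
    have h : S * l <= S * L.+1%:R.
      apply: ler_wpM2l => //; have /andP[_ l2] := ln2_bounds R.
      have : l <= L.+1%:R * ln 2.
        by rewrite mulr_natl -lnXn // ler_ln ?posrE ?exprn_gt0 // ltW.
      by move/le_trans; apply; rewrite ler_piMr.
    rewrite exprS; lra.
  have J6 : J.+1%:R <= 6 * v.
    have h1 : J%:R <= 4 * v.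
      apply: le_root => //; first by rewrite mulr_ge0 // ltW.
      rewrite exprMn vb -natrX; apply: (@le_trans _ _ L.+1%:R); first by rewrite ler_nat.
      apply: (@le_trans _ _ (4 * l)); first by rewrite -natr1; lra.
      by rewrite ler_wpM2r ?(ltW l0) // le_pow.
    have h2 : 1 <= 2 * v.
      apply: le_root => //; first by rewrite mulr_ge0 // ltW.
      rewrite exprMn vb expr1n; apply: (@le_trans _ _ (2 * l)); first by lra.
      by rewrite ler_wpM2r ?(ltW l0) // le_pow.
    rewrite -natr1; lra.
  apply: (@le_trans _ _ (S * J.+1%:R)); first by rewrite -sV ler_nat.
  apply: (@le_trans _ _ ((12 * x / l) * (6 * v))).
    by apply: ler_pM => //; rewrite ler_pdivlMr.
  by rewrite le_eqVlt; apply/orP; left; apply/eqP; field; rewrite gt_eqF.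
have [La|aL] := leqP L a.
  (* for bounded [x] it suffices that [3 = 2 + a ^ (0 ^ b)] is counted *)
  apply: (@le_trans _ _ 1); last first.
    rewrite ler1n; apply: (@leq_trans (size [:: 3%N])) => //.
    apply: leq_count_prime_plus_power => // n; rewrite inE => /eqP ->.
    split => //; exists 2%N, 0%N; split => //.
    by rewrite exp0n.
  have v2l : v <= 2 * l.
    apply: le_root; [exact: ltW|by rewrite mulr_ge0 // ltW|].
    rewrite vb; apply: (@le_trans _ _ (2 * l)); first by lra.
    rewrite -(prednK b0) exprS; apply: ler_peMr; first by lra.
    by apply: exprn_ege1; lra.
  apply: (@le_trans _ _ (c1b * (x * v / l))); first by rewrite ler_wpM2r // ge_min lexx orbT.
  rewrite /c1b ler_pdivrMl ?exprn_gt0 // mulr1 -mulrA.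
  apply: (@le_trans _ _ (x * 2)).
    by rewrite ler_pM2l // ler_pdivrMr.
  rewrite exprS mulrC ler_pM2l //; apply: le_trans (ltW xL) _.
  by rewrite ler_eXn2l // ?ltr1n // ltnS.
(* primes up to [2 ^ M] and powers up to [2 ^ M] have sums up to [2 ^ L <= x] *)
pose M := L.-1; have ML : L = M.+1 by rewrite prednK.
have aM : (a <= M)%N by rewrite -ltnS -ML.
have [J /andP[JM MJ]] := nat_root_exists (M %/ a) b0.
have J0 : (0 < J)%N.
  case: J {JM} MJ => // MJ; have : (0 < M %/ a)%N by rewrite divn_gt0.
  by rewrite exp1n in MJ; case: (M %/ a)%N MJ.
have aJ : (a * J ^ b <= M)%N.
  by rewrite mulnC; apply: leq_trans (leq_mul JM (leqnn a)) (leq_trunc_div _ _).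
have JM' : (J <= M)%N.
  apply: leq_trans aJ; apply: (@leq_trans (J ^ b)); last by rewrite leq_pmull.
  by rewrite -{1}(expn1 J) leq_pexp2l.
have := low M J J0 JM'; set V := prime_power_sums _ _ _ _ => lowV.
have VA : (size V <= count_prime_plus_power a b x)%N.
  apply: leq_count_prime_plus_power; first exact: undup_uniq.
  move=> n; rewrite mem_undup => /mapP[q /allpairsP[[p j] /= [ps js ->]] ->] /=.
  move: ps; rewrite mem_filter mem_iota add0n ltnS => /and3P[pp _ pM].
  move: js; rewrite mem_iota add1n ltnS => /andP[j1 jJ].
  split; [by rewrite addn_gt0 prime_gt0| |by exists p, j].
  apply: le_trans Lx; rewrite -natrX ler_nat ML expnS mul2n -addnn; apply: leq_add => //.
  apply: (@leq_trans ((2 ^ a) ^ (j ^ b))).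
    by rewrite leq_exp2r ?expn_gt0 ?j1 // ltnW // ltn_expl.
  rewrite -expnM leq_exp2l //; apply: leq_trans aJ.
  by rewrite leq_mul2l leq_exp2r // jJ orbT.
have vJ : v <= 4 * a%:R * J%:R.
  apply: le_root; [exact: ltW|by rewrite !mulr_ge0|].
  rewrite vb; apply: (@le_trans _ _ (2 * L%:R)) => //.
  have LaJ : (L <= a * J.+1 ^ b)%N.
    rewrite ML mulnC; apply: leq_trans (ltn_ceil M a0) _.
    by rewrite leq_mul2r MJ orbT.
  have J2 : (J.+1 ^ b <= (2 * J) ^ b)%N by rewrite leq_exp2r // mul2n -addnn -addn1 leq_add2l.
  have : (2 * L <= (2 * a) * (2 * J) ^ b)%N.
    by rewrite -mulnA leq_mul2l /=; apply: leq_trans LaJ _; rewrite leq_mul2l J2 orbT.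
  have a2 : ((2 * a) * (2 * J) ^ b <= (2 * a) ^ b * (2 * J) ^ b)%N.
    rewrite leq_mul2r; apply/orP; right.
    by rewrite -{1}(expn1 (2 * a)) leq_pexp2l // muln_gt0.
  move=> /leq_trans/(_ a2); rewrite -expnMn -(ler_nat R) natrM natrX !natrM.
  by move/le_trans; apply; rewrite le_eqVlt; apply/orP; left; apply/eqP; congr (_ ^+ _); ring.
apply: (@le_trans _ _ (c1a * (x * v / l))); first by rewrite ler_wpM2r // ge_min lexx.
apply: (@le_trans _ _ (size V)%:R); last by rewrite ler_nat.
have M0 : 0 < M%:R :> R by rewrite ltr0n; apply: leq_trans aM.
have ML' : M%:R <= 2 * l by apply: (@le_trans _ _ L%:R); [rewrite ler_nat ML|lra].
have xM : x <= 4 * 2 ^+ M.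
  by apply: le_trans (ltW xL) _; rewrite ML !exprS; lra.
have lowl : c * 2 ^+ M * J%:R <= 2 * l * (size V)%:R.
  by apply: le_trans lowV _; rewrite ler_wpM2r.
rewrite mulrA ler_pdivrMr //.
have h : x * v <= (4 * 2 ^+ M) * (4 * a%:R * J%:R) by apply: ler_pM => //; apply: ltW.
apply: (@le_trans _ _ (c1a * ((4 * 2 ^+ M) * (4 * a%:R * J%:R)))).
  by rewrite ler_wpM2l // ltW.
have -> : c1a * (4 * 2 ^+ M * (4 * a%:R * J%:R)) = (c * 2 ^+ M * J%:R) / 2.
  by rewrite /c1a; field; rewrite gt_eqF.
lra.
Qed.
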